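(* Let $K$ be an arbitrary field of characteristic other than two, let $m,n$ be positive integers and let $V$ be an $m$-dimensional orthogonal space over $K$. If $n>m$, then the annihilator of $V^{\otimes n}$ in the Brauer algebra $\mathfrak{B}_n(m)$ is $$\operatorname{Ann}_{\mathfrak{B}_n(m)}\bigl(V^{\otimes n}\bigr)=\bigl\langle E_0,E_1,\dots,E_{[\frac{m+1}{2}]}\bigr\rangle,$$ the two-sided ideal of $\mathfrak{B}_n(m)$ generated by $E_0,E_1,\dots,E_{[(m+1)/2]}$.
   Context: $[x]$ denotes the largest integer not bigger than $x$. Brauer algebra. A Brauer $n$-diagram is a graph on $2n$ vertices with $n$ edges such that every vertex is incident to precisely one edge; the vertices are arranged in a top row, labeled $1,2,\dots,n$ from left to right, and a bottom row, labeled $1^-,2^-,\dots,n^-$ from left to right. $\mathrm{Bd}_n$ is the set of Brauer $n$-diagrams. $\mathfrak{B}_n(m)$ is the $K$-algebra with $K$-basis $\mathrm{Bd}_n$ and product $D_1D_2=(m\cdot 1_K)^{n(D_1,D_2)}D_1\circ D_2$, where $D_1\circ D_2$ is obtained by identifying the bottom row of $D_1$ with the top row of $D_2$ (vertex $k^-$ of $D_1$ with vertex $k$ of $D_2$) and removing the interior loops, and $n(D_1,D_2)$ is the number of interior loops. For $1\le j<n$, $s_j$ is the diagram with edges $\{j,(j+1)^-\}$, $\{j+1,j^-\}$ and $\{k,k^-\}$ for $k\ne j,j+1$; $e_j$ is the diagram with edges $\{j,j+1\}$, $\{j^-,(j+1)^-\}$ and $\{k,k^-\}$ for $k\neq j,j+1$.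 These elements generate $\mathfrak{B}_n(m)$. The symmetric group $\mathfrak{S}_n$ (acting on $\{1,\dots,n\}$ from the right) is embedded in $\mathrm{Bd}_n$ by sending $w$ to the diagram with edges $\{j,((j)w)^-\}$; $\ell$ is the usual length function on $\mathfrak{S}_n$ with respect to $s_1,\dots,s_{n-1}$. Sign of a diagram. For $0\le f\le[n/2]$ let $\mathcal{D}_f$ be the set of $d\in\mathfrak{S}_n$ with $(2j-1)d<(2j)d$ for $1\le j\le f$, $(1)d<(3)d<\cdots<(2f-1)d$ and $(2f+1)d<(2f+2)d<\cdots<(n)d$. Every $D\in\mathrm{Bd}_n$ is uniquely of the form $D=d_1^{-1}e_1e_3\cdots e_{2f-1}\sigma d_2$ with $0\le f\le[n/2]$, $d_1,d_2\in\mathcal{D}_f$ and $\sigma\in\mathfrak{S}_{\{2f+1,\dots,n\}}$; set $\operatorname{sign}(D):=(-1)^{f}(-1)^{\ell(d_1)+\ell(d_2)+\ell(\sigma)}$. The elements $E_i$. For $a,b\in\mathbb{N}=\{0,1,2,\dots\}$ with $1\le a+b\le n$, let $\mathrm{Bd}(a,b)$ be the set of $D\in\mathrm{Bd}_n$ such that (1) $D$ contains the edge $\{s,s^-\}$ for each $a+b+1\le s\le n$, and (2) $D$ connects each vertex in $\{1,\dots,a,(a+1)^-,\dots,(a+b)^-\}$ with a vertex in $\{1^-,\dots,a^-,a+1,\dots,a+b\}$. Put $E_{a,b}:=\sum_{D\in\mathrm{Bd}(a,b)}\operatorname{sign}(D)D$ and $E_i:=E_{i,m+1-i}$ for $0\le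 i\le m+1$. Action on tensor space. $V$ has an ordered basis $v_1,\dots,v_m$ with $(v_i,v_j)=\delta_{i,m+1-j}$. The right action of $\mathfrak{B}_n(m)$ on $V^{\otimes n}$ is given on generators as follows: $s_j$ interchanges the $j$-th and $(j+1)$-th tensor factors, and $(v_{i_1}\otimes\cdots\otimes v_{i_n})e_j=\delta_{i_j,m+1-i_{j+1}}\,v_{i_1}\otimes\cdots\otimes v_{i_{j-1}}\otimes\bigl(\sum_{k=1}^m v_k\otimes v_{m+1-k}\bigr)\otimes v_{i_{j+2}}\otimes\cdots\otimes v_{i_n}$. *)

(* Defs.v *)
From HB Require Import structures.
From mathcomp Require Import all_boot all_order all_algebra all_fingroup.

Set Implicit Arguments.
Unset Strict Implicit.
Unset Printing Implicit Defensive.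

Import GRing.Theory.
Local Open Scope ring_scope.

(* Everything is indexed from 0: the k-th vertex of a row, the k-th tensor    *)
(* factor and the k-th basis vector of the text have index k - 1 here.        *)

(** * Brauer diagrams *)

(* [inl i] is the i-th vertex of the top row, [inr i] of the bottom row. *)
Definition bvertex (n : nat) : finType := ('I_n + 'I_n)%type.

(* A graph in which every vertex lies on exactly one edge is encoded by the   *)
(* map sending a vertex to the other endpoint of its edge.                    *)
Record bdiag (n : nat) := BDiag {
  bd_fun :> {ffun bvertex n -> bvertex n};
  _ : [forall x, (bd_fun (bd_fun x) == x) && (bd_fun x != x)] }.

HB.instance Definition _ n := [isSub for @bd_fun n].
HB.instance Definition _ n := [Finite of bdiag n by <:].

Lemma bd_invol n (D : bdiag n) : involutive D.
Proof. by case: D => D /= /forallP P x; case/andP: (P x) => /eqP. Qed.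

Lemma bd_neq n (D : bdiag n) x : D x != x.
Proof. by case: D => D /= /forallP P; case/andP: (P x). Qed.

Lemma bdiagP n (D D' : bdiag n) : D =1 D' -> D = D'.
Proof. by move=> DD'; apply/val_inj/ffunP. Qed.

Lemma bdiag_subproof n (f : bvertex n -> bvertex n) :
  involutive f -> (forall x, f x != x) ->
  [forall x, ([ffun y => f y] ([ffun y => f y] x) == x)
               && ([ffun y => f y] x != x)].
Proof. by move=> fK fN; apply/forallP => x; rewrite !ffunE fK eqxx fN. Qed.

Definition mk_bdiag n (f : bvertex n -> bvertex n)
    (fK : involutive f) (fN : forall x, f x != x) : bdiag n :=
  BDiag (bdiag_subproof fK fN).

Lemma mk_bdiagE n (f : bvertex n -> bvertex n) fK fN x :
  @mk_bdiag n f fK fN x = f x.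
Proof. by rewrite /= ffunE. Qed.

(** * Composition of diagrams *)

(* Vertices of the three-row graph obtained from two diagrams by identifying  *)
(* the bottom row of the first one with the top row of the second one.        *)
Definition gvertex (n : nat) : finType := ('I_n + 'I_n + 'I_n)%type.

Section Glue.
Variable n : nat.

Definition gtop (i : 'I_n) : gvertex n := inl (inl i).
Definition gmid (i : 'I_n) : gvertex n := inl (inr i).
Definition gbot (i : 'I_n) : gvertex n := inr i.

Definition gupper (x : bvertex n) : gvertex n :=
  match x with inl i => gtop i | inr i => gmid i end.
Definition glower (x : bvertex n) : gvertex n :=
  match x with inl i => gmid i | inr i => gbot i end.
Definition gouter (x : bvertex n) : gvertex n :=
  match x with inl i => gtop i | inr i => gbot i end.

Definition glue (A B : bdiag n) : rel (gvertex n) := fun u v =>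
  [exists x, (gupper x == u) && (gupper (A x) == v)]
  || [exists x, (glower x == u) && (glower (B x) == v)].

(* The interior loops are the connected components without outer vertex. *)
Definition bd_loops (A B : bdiag n) : nat :=
  n_comp (glue A B) [pred u | [forall x, ~~ connect (glue A B) u (gouter x)]].

Definition bd_comp_fun (A B : bdiag n) (x : bvertex n) : bvertex n :=
  odflt x [pick y | (y != x) && connect (glue A B) (gouter x) (gouter y)].

End Glue.

(* An orbit of [g \o h], for [g] and [h] involutions such that [h] has no     *)
(* fixed point, contains zero or two fixed points of [g].                     *)
Section Walk.
Variables (H : finType) (g h : H -> H).
Hypotheses (gK : involutive g) (hK : involutive h) (hN : forall x, h x != x).

Let p x := g (h x).

Let p_inj : injective p.
Proof. exact: inj_comp (inv_inj gK) (inv_inj hK). Qed.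

Let p_iter_inj k : injective (iter k p).
Proof. by elim: k => [|k IHk] x y //= /p_inj/IHk. Qed.

Let iter_h k z : iter k p (h (iter k p z)) = h z.
Proof.
elim: k => // k IHk; rewrite iterSr -[RHS]IHk iterS.
by congr iter; rewrite /p hK gK.
Qed.

Let iter_g k z : iter k p (g (iter k p z)) = g z.
Proof.
elim: k => // k IHk; rewrite iterSr -[RHS]IHk iterS.
by congr iter; rewrite /p gK hK.
Qed.

Lemma walk_connect_h x y : g x = x -> fconnect p x y -> fconnect p x (h y).
Proof.
move=> gx xy; have sym := fconnect_sym p_inj.
have e : iter (findex p x y) p (h y) = h x.
  by rewrite -{2}(iter_findex xy) iter_h.
have: fconnect p (h y) (h x) by rewrite -e fconnect_iter.
rewrite sym => /(connect_trans _); apply; rewrite sym.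
by apply: connect1; rewrite /= /p hK gx.
Qed.

Lemma walk_connect_g x y : g x = x -> fconnect p x y -> fconnect p x (g y).
Proof.
move=> gx xy.
have -> : g y = p (h y) by rewrite /p hK.
exact: connect_trans (walk_connect_h gx xy) (fconnect1 _ _).
Qed.

Lemma walk_end x : g x = x ->
  exists y, [/\ y != x, fconnect p x y, g y = y &
    forall z, fconnect p x z -> g z = z -> z = x \/ z = y].
Proof.
move=> gx; set N := fingraph.order p x.
have N0 : (0 < N)%N by exact: fingraph.order_gt0.
have pN : iter N p x = x by exact: fingraph.iter_order.
have small k : (k < N)%N -> iter k p x = x -> k = 0%N.
  by move=> kN e; rewrite -(findex_iter kN) e findex0.
have hx : iter N.-1 p x = h x.
  by apply: p_inj; rewrite -iterS prednK // pN /p hK gx.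
have Neven : ~~ odd N.
  apply/negP => Nodd; case/negP: (hN (iter N./2 p x)); apply/eqP.
  have := iter_h N./2 x; rewrite -hx.
  have -> : N.-1 = (N./2 + N./2)%N.
    by rewrite addnn -[in LHS](odd_double_half N) Nodd.
  by rewrite iterD; apply: p_iter_inj.
have N2 : (N./2 + N./2)%N = N.
  by rewrite addnn -[RHS]odd_double_half (negbTE Neven).
have ltN : (N./2 < N)%N by rewrite -{2}N2 -addn1 leq_add2l; move: N2 N0; case: N./2 => // <-.
exists (iter N./2 p x); split.
- apply/eqP => /(small _ ltN) e; by move: N2 N0; rewrite e => <-.
- exact: fconnect_iter.
- by apply: (@p_iter_inj N./2); rewrite iter_g gx -iterD N2 pN.
move=> z xz gz; have := iter_g (findex p x z) x.
have ltk := findex_max xz; rewrite -/N in ltk.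
move: (iter_findex xz) ltk; set k := findex p x z => ez ltk.
rewrite ez gz gx => e; rewrite -[in iter k p z]ez -iterD in e.
have [lt|ge] := ltnP (k + k) N.
  left; have := small _ lt e; rewrite -ez.
  by case: (k).
right; have ltkk : (k + k - N < N)%N by rewrite ltn_subLR // -addnS leq_add // ltnW.
rewrite -(subnK ge) iterD pN in e.
have /eqP := small _ ltkk e; rewrite subn_eq0 => le.
have {le ge} ek : (k + k)%N = N by apply/eqP; rewrite eqn_leq le ge.
by rewrite -ez -ek addnn doubleK.
Qed.

End Walk.

Section Comp.
Variables (n : nat) (A B : bdiag n).

Let H : finType := (bvertex n + bvertex n)%type.
Let h (u : H) : H := match u with inl x => inl (A x) | inr x => inr (B x) end.
Let g (u : H) : H := match u with
  | inl (inr i) => inr (inl i) | inr (inl i) => inl (inr i) | _ => u end.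
Let q (u : H) : gvertex n :=
  match u with inl x => gupper x | inr x => glower x end.
Let o (x : bvertex n) : H :=
  match x with inl i => inl (inl i) | inr i => inr (inr i) end.

Let hK : involutive h. Proof. by case=> x /=; rewrite bd_invol. Qed.
Let hN u : h u != u.
Proof. by case: u => x; apply/eqP => -[] /eqP; apply/negP/bd_neq. Qed.
Let gK : involutive g. Proof. by case=> [[]|[]]. Qed.
Let go x : g (o x) = o x. Proof. by case: x. Qed.
Let qo x : q (o x) = gouter x. Proof. by case: x. Qed.
Let qg u : q (g u) = q u. Proof. by case: u => [[]|[]]. Qed.
Let gfix u : g u = u -> exists x, u = o x.
Proof.
by case: u => [[i|i]|[i|i]] //= _; [exists (inl i) | exists (inr i)].
Qed.
Let q_eq u v : q u = q v -> u = v \/ u = g v.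
Proof.
case: u v => [[i|i]|[i|i]] [[j|j]|[j|j]] //=;
  by rewrite /gtop /gmid /gbot => -[->]; auto.
Qed.
Let o_inj : injective o. Proof. by case=> i [] j //= [->]. Qed.

Let glueP u v : reflect (exists2 x, u = q x & v = q (h x)) (glue A B u v).
Proof.
apply: (iffP orP).
  by case=> /existsP[x /andP[/eqP<- /eqP<-]]; [exists (inl x)|exists (inr x)].
case=> -[x|x] -> ->; [left|right]; apply/existsP; exists x; exact/andP.
Qed.

Lemma glue_sym : symmetric (glue A B).
Proof.
by move=> u v; apply/glueP/glueP => -[x -> ->]; exists (h x); rewrite ?hK.
Qed.

Lemma glue_connect_sym : connect_sym (glue A B).
Proof. exact: sym_connect_sym glue_sym. Qed.

Let connect_walk x u : fconnect (fun u => g (h u)) (o x) u ->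
  connect (glue A B) (gouter x) (q u).
Proof.
move=> xu; rewrite -(iter_findex xu) -qo.
elim: (findex _ _ _) => //= k IHk; apply: connect_trans IHk _.
by apply/connect1/glueP; exists (iter k (fun u => g (h u)) (o x)); rewrite ?qg.
Qed.

Let walk_connect x v : connect (glue A B) (gouter x) v ->
  exists2 u, fconnect (fun u => g (h u)) (o x) u & v = q u.
Proof.
case/connectP => s; elim/last_ind: s v => [|s w IHs] v /=.
  by move=> _ ->; exists (o x); rewrite ?connect0.
rewrite rcons_path last_rcons => /andP[/IHs/(_ erefl)[u xu ->] /glueP[y yu ->]] ->.
exists (h y) => //; apply: walk_connect_h => //.
by case: (q_eq yu) => e; [rewrite -e | rewrite -[y]gK -e; apply: walk_connect_g].
Qed.

Lemma glue_outer x : exists y, [/\ y != x,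
  connect (glue A B) (gouter x) (gouter y) &
  forall z, connect (glue A B) (gouter x) (gouter z) -> z = x \/ z = y].
Proof.
have [v [vx xv gv uniq_v]] := walk_end gK hK hN (go x).
have [y vy] := gfix gv; exists y; split.
- by rewrite -(inj_eq o_inj) -vy.
- by rewrite -(qo y) -vy connect_walk.
move=> z /walk_connect[u xu]; rewrite -(qo z) => /q_eq e.
have {}e : u = o z by case: e => [->|e] //; rewrite -[u]gK -e go.
rewrite e in xu; case: (uniq_v _ xu (go z)) => [/o_inj|]; first by left.
by rewrite vy => /o_inj; right.
Qed.

Let comp_fun_spec x : let y := bd_comp_fun A B x in [/\ y != x,
  connect (glue A B) (gouter x) (gouter y) &
  forall z, connect (glue A B) (gouter x) (gouter z) -> z = x \/ z = y].
Proof.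
have [z [zx xz Uz]] := glue_outer x; rewrite /bd_comp_fun.
case: pickP => [w /andP[wx xw]|/(_ z)] /=; last by rewrite zx xz.
have [e|wz] := Uz w xw; first by rewrite e eqxx in wx.
by split=> //; rewrite wz.
Qed.

Lemma bd_comp_funP x y :
  reflect (y != x /\ connect (glue A B) (gouter x) (gouter y))
          (y == bd_comp_fun A B x).
Proof.
apply: (iffP eqP) => [->|[yx xy]]; have [zx xz Uz] := comp_fun_spec x => //.
by have [e|] := Uz y xy; first by rewrite e eqxx in yx.
Qed.

Lemma bd_comp_funK : involutive (bd_comp_fun A B).
Proof.
move=> x; apply/esym/eqP/bd_comp_funP.
have /bd_comp_funP[yx xy] := eqxx (bd_comp_fun A B x).
by rewrite eq_sym yx glue_connect_sym xy.
Qed.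

Lemma bd_comp_fun_neq x : bd_comp_fun A B x != x.
Proof. by have /bd_comp_funP[] := eqxx (bd_comp_fun A B x). Qed.

Definition bd_comp : bdiag n := mk_bdiag bd_comp_funK bd_comp_fun_neq.

Lemma bd_compP x y :
  reflect (y != x /\ connect (glue A B) (gouter x) (gouter y))
          (y == bd_comp x).
Proof. by rewrite mk_bdiagE; apply: bd_comp_funP. Qed.

End Comp.

(* The diagram of a permutation: edges {j, (w j)^-}. *)
Definition bd_perm_fun n (w : 'S_n) (x : bvertex n) : bvertex n :=
  match x with inl j => inr (w j) | inr j => inl ((w^-1)%g j) end.

Lemma bd_perm_funK n (w : 'S_n) : involutive (bd_perm_fun w).
Proof. by case=> j /=; rewrite ?permK ?permKV. Qed.

Lemma bd_perm_fun_neq n (w : 'S_n) x : bd_perm_fun w x != x.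
Proof. by case: x. Qed.

Definition bd_perm n (w : 'S_n) : bdiag n :=
  mk_bdiag (@bd_perm_funK n w) (@bd_perm_fun_neq n w).

Definition bd_one n : bdiag n := bd_perm 1%g.

(** * Simple reflections and generators *)

(* For [j : 'I_n.-1], the pair of consecutive indices j, j + 1 in ['I_n]. *)
Definition adjl n (j : 'I_n.-1) : 'I_n := widen_ord (leq_pred n) j.

Lemma adjr_subproof n (j : 'I_n.-1) : (j.+1 < n)%N.
Proof. by rewrite -ltn_predRL. Qed.

Definition adjr n (j : 'I_n.-1) : 'I_n := Ordinal (adjr_subproof j).

Lemma adj_neq n (j : 'I_n.-1) : adjl j != adjr j.
Proof. by rewrite -val_eqE /= ltn_eqF. Qed.

Definition sperm n (j : 'I_n.-1) : 'S_n := tperm (adjl j) (adjr j).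

Definition bd_s n (j : 'I_n.-1) : bdiag n := bd_perm (sperm j).

Definition bd_e_fun n (j : 'I_n.-1) (x : bvertex n) : bvertex n :=
  let touched k := (k == adjl j) || (k == adjr j) in
  match x with
  | inl k => if touched k then inl (sperm j k) else inr k
  | inr k => if touched k then inr (sperm j k) else inl k
  end.

Lemma bd_e_funK n (j : 'I_n.-1) : involutive (bd_e_fun j).
Proof.
have t k : (k == adjl j) || (k == adjr j) ->
    (sperm j k == adjl j) || (sperm j k == adjr j).
  by case/orP=> /eqP->; rewrite /sperm ?tpermL ?tpermR eqxx ?orbT.
by case=> k /=; case: ifP => /= tk; rewrite ?(t _ tk) ?tk // /sperm tpermK.
Qed.

Lemma bd_e_fun_neq n (j : 'I_n.-1) x : bd_e_fun j x != x.
Proof.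
have t k : (k == adjl j) || (k == adjr j) -> sperm j k != k.
  case/orP=> /eqP->; rewrite /sperm ?tpermL ?tpermR ?adj_neq //.
  by rewrite eq_sym adj_neq.
case: x => k /=; case: ifP => // /t /eqP kN; apply/eqP => -[] e; exact: kN.
Qed.

Definition bd_e n (j : 'I_n.-1) : bdiag n :=
  mk_bdiag (@bd_e_funK n j) (@bd_e_fun_neq n j).

(** * Length in the symmetric group *)

Definition has_word n (w : 'S_n) (k : nat) : bool :=
  [exists t : k.-tuple 'I_n.-1, w == (\prod_(j <- t) sperm j)%g].

Lemma has_wordM n (v w : 'S_n) : (exists k, has_word v k) ->
  (exists k, has_word w k) -> exists k, has_word (v * w)%g k.
Proof.
case=> k /existsP[s /eqP->] [l /existsP[t /eqP->]].
by exists (k + l)%N; apply/existsP; exists (cat_tuple s t); rewrite big_cat.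
Qed.

Lemma has_word_sperm n (j : 'I_n.-1) : exists k, has_word (sperm j) k.
Proof. by exists 1%N; apply/existsP; exists [tuple j]; rewrite big_seq1. Qed.

Lemma has_word_tperm n d (x y : 'I_n) : (y = x + d.+1 :> nat)%N ->
  exists k, has_word (tperm x y) k.
Proof.
elim: d y => [|d IHd] y e.
  have lt : (x < n.-1)%N by have := ltn_ord y; rewrite e addn1 ltn_predRL.
  have -> : tperm x y = sperm (Ordinal lt).
    by congr tperm; apply: val_inj; rewrite //= e addn1.
  exact: has_word_sperm.
have ltxd : (x + d.+1 < n.-1)%N by have := ltn_ord y; rewrite e addnS ltn_predRL.
pose j := Ordinal ltxd.
have yE : y = adjr j by apply: val_inj; rewrite /= e addnS.
have [k kP] := IHd (adjl j) erefl.
have -> : tperm x y = (sperm j * (tperm x (adjl j) * sperm j))%g.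
  have -> : (sperm j * (tperm x (adjl j) * sperm j)
             = tperm x (adjl j) ^ sperm j)%g by rewrite conjgE tpermV.
  rewrite tpermJ yE {2}/sperm tpermL; congr tperm; rewrite /sperm tpermD //.
    by rewrite -val_eqE /= gtn_eqF // addnS ltnS leq_addr.
  by rewrite -val_eqE /= gtn_eqF // addnS !ltnS -addnS leq_addr.
apply: has_wordM; first exact: has_word_sperm.
by apply: has_wordM; [exists k | exact: has_word_sperm].
Qed.

Lemma has_word_ex n (w : 'S_n) : exists k, has_word w k.
Proof.
have [ts -> tsP] := prod_tpermP w; elim: ts tsP => [|t ts IHts] /=.
  by move=> _; exists 0%N; apply/existsP; exists [tuple]; rewrite !big_nil.
case/andP=> tP /IHts{}IHts; rewrite big_cons; apply: has_wordM => //.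
case: t tP => x y /=; rewrite -val_eqE /= neq_ltn => /orP[] lt.
  by apply: (@has_word_tperm _ (y - x).-1); rewrite prednK ?subn_gt0 // subnKC // ltnW.
rewrite tpermC.
by apply: (@has_word_tperm _ (x - y).-1); rewrite prednK ?subn_gt0 // subnKC // ltnW.
Qed.

Definition perm_length n (w : 'S_n) : nat := ex_minn (has_word_ex w).

(** * The Brauer algebra *)

(* Formal linear combinations of diagrams; the parameter [m] only enters the  *)
(* product. The type is an alias of a type of finite functions, whose         *)
(* pointwise product is not the one used here.                                *)
Definition brauer (K : fieldType) (m n : nat) : Type := {ffun bdiag n -> K^o}.

HB.instance Definition _ (K : fieldType) (m n : nat) :=
  GRing.Lmodule.copy (brauer K m n) {ffun bdiag n -> K^o}.

(* Counting the colourings of the glued graph turns identities between        *)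
(* composites and loop numbers into identities between boolean matrices.      *)
Section Colour.
Variables (n : nat) (C : finType).
Implicit Types (i j k : {ffun 'I_n -> C}) (A B D : bdiag n).

Definition bcolour i k (x : bvertex n) : C :=
  match x with inl a => i a | inr a => k a end.

Definition compat D i k : bool :=
  [forall x, bcolour i k (D x) == bcolour i k x].

Let gcolour i j k (u : gvertex n) : C :=
  match u with inl (inl a) => i a | inl (inr a) => j a | inr a => k a end.

Let gcolour_upper i j k x : gcolour i j k (gupper x) = bcolour i j x.
Proof. by case: x. Qed.
Let gcolour_lower i j k x : gcolour i j k (glower x) = bcolour j k x.
Proof. by case: x. Qed.
Let gcolour_outer i j k x : gcolour i j k (gouter x) = bcolour i k x.
Proof. by case: x. Qed.

Let compat_glue A B i j k :
  reflect (forall u v, glue A B u v -> gcolour i j k v = gcolour i j k u)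
          (compat A i j && compat B j k).
Proof.
apply: (iffP andP) => [[/forallP cA /forallP cB] u v | cAB].
  case/orP => /existsP[x /andP[/eqP<- /eqP<-]].
    by rewrite !gcolour_upper (eqP (cA x)).
  by rewrite !gcolour_lower (eqP (cB x)).
split; apply/forallP => x; apply/eqP.
  rewrite -!(gcolour_upper i j k); apply: cAB; apply/orP; left.
  by apply/existsP; exists x; rewrite !eqxx.
rewrite -!(gcolour_lower i j k); apply: cAB; apply/orP; right.
by apply/existsP; exists x; rewrite !eqxx.
Qed.

Let glue_const A B i j k :
  (forall u v, glue A B u v -> gcolour i j k v = gcolour i j k u) ->
  forall u v, connect (glue A B) u v -> gcolour i j k v = gcolour i j k u.
Proof.
move=> cP u v /connectP[s]; elim: s u => [|w s IHs] u /=; first by move=> _ ->.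
by case/andP => /cP <- /IHs; apply.
Qed.

Lemma card_compat A B i k :
  #|[set j | compat A i j && compat B j k]|
    = (#|C| ^ bd_loops A B * compat (bd_comp A B) i k)%N.
Proof.
set e := glue A B; pose a := [pred u | [forall x, ~~ connect e u (gouter x)]].
have symC : connect_sym e by exact: glue_connect_sym.
have [cD|/negP ncD] := boolP (compat _ i k); last first.
  rewrite muln0; apply/eqP; rewrite cards_eq0; apply/eqP/setP => j.
  rewrite !inE; apply/negP => /compat_glue/glue_const cP; case: ncD.
  apply/forallP => x; have /bd_compP[_ xD] := eqxx (bd_comp A B x).
  by rewrite -!(gcolour_outer i j k) (cP _ _ xD).
have cout x y : connect e (gouter x) (gouter y) ->
    bcolour i k y = bcolour i k x.
  move=> xy; have [->//|yx] := eqVneq y x.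
  have /eqP-> : y == bd_comp A B x by apply/bd_compP.
  exact/eqP/(forallP cD).
have aP u v : connect e u v -> a u = a v.
  by move=> uv; apply: eq_forallb => x; rewrite (same_connect symC uv).
pose I := {u : gvertex n | u \in predI (roots e) a}.
have -> : bd_loops A B = #|{: I}| by rewrite card_sig.
rewrite muln1 -card_ffun.
pose phi (f : {ffun I -> C}) : {ffun 'I_n -> C} :=
  [ffun b => if [pick x | connect e (gmid b) (gouter x)] is Some x
     then bcolour i k x
     else oapp f (i b) (insub (fingraph.root e (gmid b)) : option I)].
have phi_out f b x : connect e (gmid b) (gouter x) ->
    phi f b = bcolour i k x.
  move=> bx; rewrite ffunE; case: pickP => [y by_|/(_ x)]; last by rewrite bx.
  by apply: cout; apply: connect_trans by_; rewrite symC.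
have phi_in f b (r : I) : connect e (gmid b) (val r) -> phi f b = f r.
  move=> br; have /andP[/= rr ar] := valP r.
  rewrite ffunE; case: pickP => [y by_|_].
    case/negP: (forallP ar y); apply: connect_trans by_.
    by rewrite symC.
  have e1 : fingraph.root e (gmid b) = val r.
    by rewrite (elimT (fingraph.rootP symC) br) (eqP rr).
  by rewrite e1 valK.
have in_mid (r : I) : exists b, val r = gmid b.
  have /andP[/= _ /forallP ar] := valP r; case: (val r) ar => [[b|b]|b] ar.
  - by have := ar (inl b); rewrite /= connect0.
  - by exists b.
  - by have := ar (inr b); rewrite /= connect0.
have phi_inj : injective phi.
  move=> f1 f2 e12; apply/ffunP => r; have [b rb] := in_mid r.
  by rewrite -!(@phi_in _ b r) ?e12 // rb connect0.
rewrite -(card_imset _ phi_inj); apply: eq_card => j; rewrite !inE.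
have cls b : (exists x, connect e (gmid b) (gouter x)) \/
             (exists r : I, connect e (gmid b) (val r)).
  have [ab|] := boolP (a (gmid b)); last first.
    by move/forallPn => [x]; rewrite negbK; left; exists x.
  right; have br := connect_root e (gmid b).
  have rI : fingraph.root e (gmid b) \in predI (roots e) a.
    by apply/andP; split; [apply: roots_root | move: ab; rewrite (aP _ _ br)].
  by exists (Sub (fingraph.root e (gmid b)) rI : I).
apply/idP/imsetP => [/compat_glue/glue_const cP | [f _ ->]].
  pose pickb (r : I) : C := gcolour i j k (val r).
  exists [ffun r => pickb r] => //; apply/ffunP => b.
  case: (cls b) => [[x bx]|[r br]].
    by rewrite (phi_out _ _ _ bx) -(gcolour_outer i j k) (cP _ _ bx).
  by rewrite (phi_in _ _ _ br) ffunE /pickb (cP _ _ br).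
apply/compat_glue.
have gout u x : connect e u (gouter x) ->
    gcolour i (phi f) k u = bcolour i k x.
  case: u => [[b|b]|b] bx /=.
  - by rewrite (@cout (inl b) x bx).
  - exact: phi_out.
  - by rewrite (@cout (inr b) x bx).
have gin u (r : I) : connect e u (val r) -> gcolour i (phi f) k u = f r.
  have /andP[_ /forallP ar] := valP r.
  case: u => [[b|b]|b] br /=; last 2 first.
  - exact: phi_in.
  - by case/negP: (ar (inr b)); rewrite symC.
  by case/negP: (ar (inl b)); rewrite symC.
move=> u v uv; have vu : connect e v u by rewrite symC connect1.
have [[x ux]|[r ur]] : (exists x, connect e u (gouter x)) \/
             (exists r : I, connect e u (val r)).
  case: u uv vu => [[b|b]|b] _ _; last 2 first.
  - exact: cls.
  - by left; exists (inr b).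
  by left; exists (inl b).
- by rewrite (gout _ _ ux) (gout _ _ (connect_trans vu ux)).
- by rewrite (gin _ _ ur) (gin _ _ (connect_trans vu ur)).
Qed.

End Colour.

Lemma compat_eq n (D D' : bdiag n) a b :
  (forall i k : {ffun 'I_n -> bool},
     2 ^ a * compat D i k = 2 ^ b * compat D' i k)%N -> a = b /\ D = D'.
Proof.
move=> eqDD'.
have ab : a = b.
  have := eqDD' [ffun=> true] [ffun=> true].
  have c E : compat E [ffun=> true] [ffun=> true] :> bool.
    by apply/forallP => -[] x; case: (E _) => y /=; rewrite !ffunE.
  by rewrite !c !muln1 => /eqP; rewrite eqn_exp2l // => /eqP.
split=> //; apply: bdiagP => x.
pose i : {ffun 'I_n -> bool} := [ffun y => inl y \in [:: x; D x]].
pose k : {ffun 'I_n -> bool} := [ffun y => inr y \in [:: x; D x]].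
have cE y : bcolour i k y = (y \in [:: x; D x]) by case: y => y; rewrite /= ffunE.
have := eqDD' i k; rewrite ab => /eqP; rewrite eqn_pmul2l ?expn_gt0 //.
have -> : compat D i k.
  apply/forallP => y; rewrite !cE !inE (inv_eq (@bd_invol n D)).
  by rewrite (inj_eq (inv_inj (@bd_invol n D))) orbC.
case: (boolP (compat D' i k)) => // /forallP/(_ x) + _; rewrite !cE !inE eqxx /= => /eqP.
by rewrite (negbTE (bd_neq _ _)) => /eqP.
Qed.

Lemma card_compat_sum n (A B : bdiag n) (i k : {ffun 'I_n -> bool}) :
  (\sum_j compat A i j * compat B j k
     = 2 ^ bd_loops A B * compat (bd_comp A B) i k)%N.
Proof.
rewrite -card_bool -card_compat -sum1dep_card [RHS]big_mkcond.
by apply: eq_bigr => j _; case: (compat A i j); case: (compat B j k).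
Qed.

Lemma bd_compA n (A B D : bdiag n) :
  (bd_loops B D + bd_loops A (bd_comp B D)
     = bd_loops A B + bd_loops (bd_comp A B) D)%N /\
  bd_comp A (bd_comp B D) = bd_comp (bd_comp A B) D.
Proof.
apply: compat_eq => i k; rewrite !expnD -!mulnA -!card_compat_sum.
rewrite !big_distrr /=.
under eq_bigr => j _ do rewrite mulnCA -card_compat_sum big_distrr /=.
rewrite exchange_big; apply: eq_bigr => l _ /=.
rewrite mulnA -card_compat_sum big_distrl /=.
by apply: eq_bigr => j _; rewrite mulnA.
Qed.

Lemma compat_one n (i k : {ffun 'I_n -> bool}) :
  compat (bd_one n) i k = (i == k).
Proof.
apply/forallP/eqP => [c | -> [] a]; last 2 first.
- by rewrite mk_bdiagE /= perm1.
- by rewrite mk_bdiagE /= invg1 perm1.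
by apply/ffunP => a; have := c (inl a); rewrite mk_bdiagE /= perm1 => /eqP.
Qed.

Lemma bd_comp1l n (D : bdiag n) :
  bd_loops (bd_one n) D = 0%N /\ bd_comp (bd_one n) D = D.
Proof.
apply: compat_eq => i k; rewrite -card_compat_sum (bigD1 i) //=.
rewrite compat_one eqxx big1 ?addn0 // => j ji.
by rewrite compat_one eq_sym (negbTE ji).
Qed.

Lemma bd_comp1r n (D : bdiag n) :
  bd_loops D (bd_one n) = 0%N /\ bd_comp D (bd_one n) = D.
Proof.
apply: compat_eq => i k; rewrite -card_compat_sum (bigD1 k) //=.
rewrite compat_one eqxx big1 ?addn0 ?muln1 ?mul1n // => j jk.
by rewrite compat_one (negbTE jk) muln0.
Qed.

Section BrauerAlgebra.
Variables (K : fieldType) (m n : nat).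
Implicit Types (x y z : brauer K m n) (D : bdiag n).

Definition bd_basis D : brauer K m n := [ffun D' => (D' == D)%:R].

Definition brauer_mul x y : brauer K m n :=
  \sum_D1 \sum_D2
    (x D1 * y D2 * m%:R ^+ bd_loops D1 D2) *: bd_basis (bd_comp D1 D2).

Lemma brauerE x : x = \sum_D x D *: bd_basis D.
Proof.
apply/ffunP => D; rewrite sum_ffunE (bigD1 D) //= big1 => [|D' DD'].
  by rewrite !ffunE eqxx addr0 /GRing.scale /= mulr1.
by rewrite !ffunE eq_sym (negbTE DD') scaler0.
Qed.

Fact brauer_mulDl : left_distributive brauer_mul +%R.
Proof.
move=> x y z; rewrite -big_split; apply: eq_bigr => D1 _ /=.
rewrite -big_split; apply: eq_bigr => D2 _ /=.
by rewrite ffunE -scalerDl !mulrDl.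
Qed.

Fact brauer_mulDr : right_distributive brauer_mul +%R.
Proof.
move=> x y z; rewrite -big_split; apply: eq_bigr => D1 _ /=.
rewrite -big_split; apply: eq_bigr => D2 _ /=.
by rewrite ffunE -scalerDl mulrDr mulrDl.
Qed.

Fact brauer_mulZl c x y : c *: brauer_mul x y = brauer_mul (c *: x) y.
Proof.
rewrite scaler_sumr; apply: eq_bigr => D1 _; rewrite scaler_sumr.
by apply: eq_bigr => D2 _; rewrite scalerA ffunE /GRing.scale /= !mulrA.
Qed.

Fact brauer_mulZr c x y : c *: brauer_mul x y = brauer_mul x (c *: y).
Proof.
rewrite scaler_sumr; apply: eq_bigr => D1 _; rewrite scaler_sumr.
apply: eq_bigr => D2 _; rewrite scalerA ffunE /GRing.scale /=.
by rewrite !mulrA [c * _]mulrC.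
Qed.

Lemma brauer_mul_basis D1 D2 : brauer_mul (bd_basis D1) (bd_basis D2)
  = m%:R ^+ bd_loops D1 D2 *: bd_basis (bd_comp D1 D2).
Proof.
rewrite /brauer_mul (bigD1 D1) //= (bigD1 D2) //= !ffunE !eqxx !mul1r.
rewrite big1 ?addr0 => [|D DD]; last first.
  by rewrite !ffunE (negbTE DD) mulr0 mul0r scale0r.
rewrite big1 ?addr0 // => D DD; rewrite big1 // => D' _.
by rewrite !ffunE (negbTE DD) !mul0r scale0r.
Qed.

Let mul0b x : brauer_mul 0 x = 0.
Proof. by have := brauer_mulZl 0 0 x; rewrite !scale0r. Qed.
Let mulb0 x : brauer_mul x 0 = 0.
Proof. by have := brauer_mulZr 0 x 0; rewrite !scale0r. Qed.

Let mul_suml I (r : seq I) F y :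
  brauer_mul (\sum_(i <- r) F i) y = \sum_(i <- r) brauer_mul (F i) y.
Proof. exact: (big_morph (brauer_mul^~ y) (fun a b => brauer_mulDl a b y) (mul0b y)). Qed.
Let mul_sumr I (r : seq I) F y :
  brauer_mul y (\sum_(i <- r) F i) = \sum_(i <- r) brauer_mul y (F i).
Proof. exact: (big_morph (brauer_mul y) (brauer_mulDr y) (mulb0 y)). Qed.

Fact brauer_mulA : associative brauer_mul.
Proof.
have assoc3 A B D : brauer_mul (bd_basis A) (brauer_mul (bd_basis B) (bd_basis D))
    = brauer_mul (brauer_mul (bd_basis A) (bd_basis B)) (bd_basis D).
  rewrite !brauer_mul_basis -brauer_mulZl -brauer_mulZr !brauer_mul_basis.
  by have [eL ->] := bd_compA A B D; rewrite !scalerA -!exprD eL.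
have assoc2 A B z : brauer_mul (bd_basis A) (brauer_mul (bd_basis B) z)
    = brauer_mul (brauer_mul (bd_basis A) (bd_basis B)) z.
  rewrite (brauerE z) [RHS]mul_sumr [brauer_mul (bd_basis B) _]mul_sumr.
  rewrite [LHS]mul_sumr; apply: eq_bigr => D _.
  by rewrite -!brauer_mulZr assoc3.
have assoc1 A y z : brauer_mul (bd_basis A) (brauer_mul y z)
    = brauer_mul (brauer_mul (bd_basis A) y) z.
  rewrite (brauerE y) [brauer_mul (\sum_D _) z]mul_suml [LHS]mul_sumr.
  rewrite [brauer_mul (bd_basis A) (\sum_D _)]mul_sumr [RHS]mul_suml.
  apply: eq_bigr => B _.
  by rewrite -brauer_mulZl -!brauer_mulZr -brauer_mulZl assoc2.
move=> x y z; rewrite (brauerE x) [LHS]mul_suml.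
rewrite [brauer_mul (\sum_D _) y]mul_suml [RHS]mul_suml.
apply: eq_bigr => A _; by rewrite -!brauer_mulZl assoc1.
Qed.

Fact brauer_mul1l : left_id (bd_basis (bd_one n)) brauer_mul.
Proof.
move=> x; rewrite [in RHS](brauerE x) {1}(brauerE x) mul_sumr.
apply: eq_bigr => D _; rewrite -brauer_mulZr brauer_mul_basis.
by have [-> ->] := bd_comp1l D; rewrite expr0 scale1r.
Qed.

Fact brauer_mul1r : right_id (bd_basis (bd_one n)) brauer_mul.
Proof.
move=> x; rewrite [in RHS](brauerE x) {1}(brauerE x) mul_suml.
apply: eq_bigr => D _; rewrite -brauer_mulZl brauer_mul_basis.
by have [-> ->] := bd_comp1r D; rewrite expr0 scale1r.
Qed.

Fact brauer_oner_neq0 : bd_basis (bd_one n) != 0.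
Proof.
by apply/eqP => /ffunP/(_ (bd_one n))/eqP; rewrite !ffunE eqxx oner_eq0.
Qed.

HB.instance Definition _ := GRing.Zmodule_isNzRing.Build (brauer K m n)
  brauer_mulA brauer_mul1l brauer_mul1r brauer_mulDl brauer_mulDr
  brauer_oner_neq0.
HB.instance Definition _ :=
  GRing.Lmodule_isLalgebra.Build K (brauer K m n) brauer_mulZl.
HB.instance Definition _ :=
  GRing.Lalgebra_isAlgebra.Build K (brauer K m n) brauer_mulZr.

End BrauerAlgebra.

(** * Signs and the elements [E a b] *)

(* The distinguished set D_f of permutations. *)
Definition dset n (f : nat) : {set 'S_n} :=
  [set d : 'S_n | [forall i : 'I_n, forall j : 'I_n,
    [&& [&& ~~ odd i, i < f.*2 & j == i.+1 :> nat] ==> (d i < d j),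
        [&& ~~ odd i, j < f.*2 & j == i.+2 :> nat] ==> (d i < d j) &
        (f.*2 <= i < j) ==> (d i < d j)]]]%N.

(* e_1 e_3 ... e_(2f - 1) *)
Definition bd_e_odd n (f : nat) : bdiag n :=
  foldr (@bd_comp n) (bd_one n)
    [seq bd_e j | j <- [seq j <- enum 'I_n.-1
                          | ~~ odd (j : 'I_n.-1) && (j < f.*2)%N]].

(* No loops arise in this product, so that it may be taken among diagrams. *)
Definition bd_factors n (D : bdiag n)
    (t : 'I_(n./2).+1 * 'S_n * 'S_n * 'S_n) : bool :=
  let: (f, d1, d2, s) := t in
  [&& d1 \in dset n f, d2 \in dset n f,
      perm_on [set k : 'I_n | (f.*2 <= k)%N] s
    & D == bd_comp (bd_comp (bd_comp (bd_perm d1^-1%g) (bd_e_odd n f))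
                            (bd_perm s)) (bd_perm d2)].

(* Every diagram has exactly one factorization, so that the last case does    *)
(* not occur.                                                                 *)
Definition bd_sign n (D : bdiag n) : int :=
  if [pick t | bd_factors D t] is Some (f, d1, d2, s) then
    (-1) ^+ f * (-1) ^+ (perm_length d1 + perm_length d2 + perm_length s)
  else 0.

Definition Bd_set n (a b : nat) : {set bdiag n} :=
  let src (x : bvertex n) :=
    match x with inl i => i < a | inr i => a <= i < a + b end%N in
  let tgt (x : bvertex n) :=
    match x with inl i => a <= i < a + b | inr i => i < a end%N in
  [set D : bdiag n |
    [forall s : 'I_n, (a + b <= s)%N ==> (D (inl s) == inr s)]
    && [forall x, src x ==> tgt (D x)]].

Definition brauer_E2 (K : fieldType) (m n a b : nat) : brauer K m n :=
  \sum_(D in Bd_set n a b) (bd_sign D)%:~R *: bd_basis K m D.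

Definition brauer_E (K : fieldType) (m n i : nat) : brauer K m n :=
  brauer_E2 K m n i (m.+1 - i).

(** * Two-sided ideals *)

Definition two_sided_ideal (A : nzRingType) (I : A -> Prop) : Prop :=
  [/\ I 0, forall x y, I x -> I y -> I (x + y),
      forall a x, I x -> I (a * x) & forall a x, I x -> I (x * a)].

Definition two_sided_ideal_gen (A : nzRingType) (S : A -> Prop) (x : A) : Prop :=
  forall I : A -> Prop,
    two_sided_ideal I -> (forall s, S s -> I s) -> I x.

(** * Tensor powers and the action *)

Section Tensor.
Variables (K : fieldType) (n : nat) (V : lmodType K).

Definition fupd (f : {ffun 'I_n -> V}) (i : 'I_n) (v : V) : {ffun 'I_n -> V} :=
  [ffun k => if k == i then v else f k].

Definition multilinear (W : lmodType K) (t : {ffun 'I_n -> V} -> W) : Prop :=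
  forall f i, linear (fun v => t (fupd f i v)).

(* [tens f] is the pure tensor of the vectors f 0, ..., f (n - 1): [T] is the *)
(* n-th tensor power of V, characterized by its universal property.           *)
Definition tensor_power (T : lmodType K) (tens : {ffun 'I_n -> V} -> T) : Prop :=
  multilinear tens /\
  forall (W : lmodType K) (t : {ffun 'I_n -> V} -> W), multilinear t ->
    exists2 h : {linear T -> W}, (forall f, h (tens f) = t f) &
      forall h' : {linear T -> W}, (forall f, h' (tens f) = t f) -> h' =1 h.

(* [act] is the right action of the Brauer algebra on the tensor power that   *)
(* takes the prescribed values on the generators, with respect to the basis   *)
(* [v] of V; [rev_ord] is the involution i |-> m + 1 - i of the text.         *)
Record brauer_action (m : nat) (v : 'I_m -> V) (T : lmodType K)
    (tens : {ffun 'I_n -> V} -> T) (act : T -> brauer K m n -> T) : Prop := {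
  brauer_act_linearl : forall x, linear (act^~ x);
  brauer_act_linearr : forall t, linear (act t);
  brauer_act1 : forall t, act t 1 = t;
  brauer_actM : forall t x y, act t (x * y) = act (act t x) y;
  brauer_act_s : forall (j : 'I_n.-1) (f : {ffun 'I_n -> V}),
    act (tens f) (bd_basis K m (bd_s j)) = tens [ffun k => f (sperm j k)];
  brauer_act_e : forall (j : 'I_n.-1) (i : {ffun 'I_n -> 'I_m}),
    let f := [ffun k => v (i k)] in
    act (tens f) (bd_basis K m (bd_e j)) =
      (i (adjl j) == rev_ord (i (adjr j)))%:R *:
        \sum_(k < m) tens (fupd (fupd f (adjl j) (v k)) (adjr j) (v (rev_ord k)))
}.

End Tensor.

(* Main.v *)
From HB Require Import structures.
Require Import Defs.
From mathcomp Require Import all_boot all_order all_algebra all_fingroup.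
From mathcomp Require Import zify.

Set Implicit Arguments.
Unset Strict Implicit.
Unset Printing Implicit Defensive.

Import GRing.Theory.
Local Open Scope ring_scope.

(** Let X be the set of the 2n vertices of a diagram. A diagram is a perfect
matching of X, and for a family g of vectors indexed by X it has a value: the
product of the scalar products of g along its edges ([contract]). The matrix
entries of the action on basis tensors are such values, so that a combination of
diagrams annihilates the tensor power if and only if all its values are zero
([annihilatorP]). The theorem is thus the multilinear part of the second
fundamental theorem of invariant theory for the orthogonal group: the linear
relations between matchings of vectors in dimension m are spanned by the minors
of size m + 1 of the matrix of scalar products ([second_fundamental]), written
here as antisymmetrizations of one end of m + 1 edges ([bd_antisym]).

A minor is zero on basis vectors, since two of its m + 1 columns are equal
([fits_antisym]). For the converse, order the vertices linearly and the
matchings lexicographically. A chain is a set of edges whose smaller and larger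
ends increase together; a chain of m + 1 edges is the leading term of a minor
([chain_conj_gt]), so that modulo minors only the matchings without such a chain
remain ([straighten]). Their edges can be coloured with m colours such that the
edges of each colour are nested, and a nested matching is the largest one with
its colour classes ([separating_colouring]). Replacing the colours by m
orthogonal vectors that are not isotropic, which exist in characteristic other
than two ([orthogonal_family]), shows by triangularity that the remaining
matchings are linearly independent.

It remains to compare minors with the elements E_i. The sign of a diagram is the
sign of its term in a Pfaffian for a suitable order of the vertices
([bd_sign_conj]); this makes E_{a,b} the minor whose rows are a vertices in the
top and b in the bottom row, and whose columns are b vertices in the top and a
in the bottom row ([brauer_E2_antisym]). Any minor of size m + 1 lies in the
ideal generated by these ([ideal_antisym]): multiplication by caps balances its
number of vertices in the two rows, row permutations bring them to the first m +
1 strands, multiplication by a diagram fills in the other strands, and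
transposing the minor exchanges a and b.

Products of diagrams are computed from boolean colourings of the rows
([bd_comp_by_colouring]); all products needed here are free of loops. *)

(** * Relabelling and composing diagrams *)

Section Conj.
Variable n : nat.
Implicit Types (D A B : bdiag n) (p q : {perm bvertex n}) (w : 'S_n).

Fact bd_conj_invol p D : involutive (fun x => p (D ((p^-1)%g x))).
Proof. by move=> x /=; rewrite permK bd_invol permKV. Qed.

Fact bd_conj_neq p D x : p (D ((p^-1)%g x)) != x.
Proof. by rewrite -{2}[x](permKV p) (inj_eq perm_inj) bd_neq. Qed.

(** The group of all permutations of the 2n vertices acts on diagrams, seen as
fixed-point free involutions, by conjugation; nearly every diagram below is
reached from another one in this way. *)
Definition bd_conj p D : bdiag n :=
  mk_bdiag (@bd_conj_invol p D) (@bd_conj_neq p D).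

Lemma bd_conjE p D x : bd_conj p D x = p (D ((p^-1)%g x)).
Proof. exact: mk_bdiagE. Qed.

Lemma bd_conj_apply p D x : bd_conj p D (p x) = p (D x).
Proof. by rewrite bd_conjE permK. Qed.

Lemma bd_conj1 D : bd_conj 1 D = D.
Proof. by apply: bdiagP => x; rewrite bd_conjE invg1 !perm1. Qed.

Lemma bd_conjM p q D : bd_conj (p * q) D = bd_conj q (bd_conj p D).
Proof. by apply: bdiagP => x; rewrite !bd_conjE invMg !permM. Qed.

Lemma bd_conj_eq p D D' : (forall x, D' (p x) = p (D x)) -> bd_conj p D = D'.
Proof. by move=> e; apply: bdiagP => x; rewrite bd_conjE -e permKV. Qed.

Definition row_fun w (b : bool) (x : bvertex n) : bvertex n :=
  match x with
  | inl i => inl (if b then i else w i)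
  | inr i => inr (if b then w i else i)
  end.

Fact row_fun_inj w b : injective (row_fun w b).
Proof.
by case: b => -[] i [] j //= [e];
  first [by rewrite e | by rewrite (perm_inj e)].
Qed.

Definition top_perm w : {perm bvertex n} := perm (@row_fun_inj w false).
Definition bot_perm w : {perm bvertex n} := perm (@row_fun_inj w true).

Lemma top_perml w i : top_perm w (inl i) = inl (w i).
Proof. by rewrite permE. Qed.
Lemma top_permr w i : top_perm w (inr i) = inr i.
Proof. by rewrite permE. Qed.
Lemma bot_perml w i : bot_perm w (inl i) = inl i.
Proof. by rewrite permE. Qed.
Lemma bot_permr w i : bot_perm w (inr i) = inr (w i).
Proof. by rewrite permE. Qed.
Definition rowpE := (top_perml, top_permr, bot_perml, bot_permr).

Lemma bd_permE w x : bd_perm w x = bd_perm_fun w x.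
Proof. exact: mk_bdiagE. Qed.

Lemma bd_oneE (x : bvertex n) :
  bd_one n x = match x with inl i => inr i | inr i => inl i end.
Proof. by rewrite bd_permE; case: x => i /=; rewrite ?invg1 perm1. Qed.

Local Notation colouring := {ffun 'I_n -> bool}.

(** Two-colourings of the rows turn composition into a product of boolean
matrices. If only one colouring of the middle row can contribute to each entry,
then no loop is free to be coloured in two ways, and the nonzero entries are
those of the composite. *)
Lemma bd_comp_by_colouring A B D :
  (forall i k : colouring, exists j0, forall j : colouring,
     compat A i j && compat B j k = (j == j0) && compat D i k) ->
  bd_loops A B = 0%N /\ bd_comp A B = D.
Proof.
move=> H; apply: compat_eq => i k; rewrite -card_compat_sum expn0 mul1n.
have [j0 Hj] := H i k.
rewrite (bigD1 j0) //= mulnb Hj eqxx big1 ?addn0 // => j /negbTE jj0.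
by rewrite mulnb Hj jj0.
Qed.

Lemma compat_perm w (i j : colouring) :
  compat (bd_perm w) i j = (j == [ffun a => i (w^-1 a)%g]).
Proof.
apply/forallP/eqP => [c | -> [] a].
- by apply/ffunP => a; have := c (inr a); rewrite bd_permE /= ffunE => /eqP.
- by rewrite bd_permE /= ffunE permK.
- by rewrite bd_permE /= ffunE.
Qed.

Lemma compatP D (i k : colouring) :
  reflect (forall x, bcolour i k (D x) = bcolour i k x) (compat D i k).
Proof. by apply: (iffP forallP) => H x; apply/eqP. Qed.

Lemma compat_conj p D (i k i' k' : colouring) :
  (forall x, bcolour i' k' (p x) = bcolour i k x) ->
  compat (bd_conj p D) i' k' = compat D i k.
Proof.
move=> e; apply/compatP/compatP => H x.
  by rewrite -!e -bd_conj_apply.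
by rewrite -[x](permKV p) bd_conj_apply !e.
Qed.

Lemma bd_comp_perml w D :
  bd_loops (bd_perm w) D = 0%N /\
  bd_comp (bd_perm w) D = bd_conj (top_perm w^-1) D.
Proof.
apply: bd_comp_by_colouring => i k; exists [ffun a => i (w^-1 a)%g] => j.
rewrite compat_perm; case: eqP => //= ->; symmetry; apply: compat_conj => -[] a.
  by rewrite rowpE /= ffunE.
by rewrite rowpE.
Qed.

Lemma bd_comp_permr w D :
  bd_loops D (bd_perm w) = 0%N /\
  bd_comp D (bd_perm w) = bd_conj (bot_perm w) D.
Proof.
apply: bd_comp_by_colouring => i k; exists [ffun a => k (w a)] => j.
rewrite andbC compat_perm.
have -> : (k == [ffun a => j (w^-1 a)%g]) = (j == [ffun a => k (w a)]).
  by apply/eqP/eqP => ->; apply/ffunP => a; rewrite !ffunE ?permK ?permKV.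
case: eqP => //= ->; symmetry; apply: compat_conj => -[] a; rewrite rowpE //=.
by rewrite ffunE.
Qed.

Definition strand (x : bvertex n) : 'I_n := match x with inl i | inr i => i end.

Definition one_on (P : pred 'I_n) D :=
  forall x, P (strand x) -> D x = bd_one n x.

Lemma strand_one x : strand (bd_one n x) = strand x.
Proof. by rewrite bd_oneE; case: x. Qed.

Lemma one_on_strand P D x : one_on P D -> P (strand (D x)) = P (strand x).
Proof.
move=> H; have [Px|nPx] := boolP (P (strand x));
  first by rewrite H // strand_one.
apply/negP => PDx; case/negP: nPx.
by rewrite -[x](bd_invol D) H // strand_one.
Qed.

(** When each strand is vertical in one of the two diagrams, composition just
juxtaposes their other parts. The unique colouring of the middle row copies the
bottom colours on [P] and the top colours off [P]. *)
Lemma bd_comp_union P A B D : one_on (predC P) A -> one_on P B ->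
  (forall x, D x = if P (strand x) then A x else B x) ->
  bd_loops A B = 0%N /\ bd_comp A B = D.
Proof.
move=> A1 B1 DE; apply: bd_comp_by_colouring => i k.
exists [ffun a => if P a then k a else i a] => j.
have [->|ne] := eqVneq; last first.
  apply: contraNF ne => /andP[/compatP cA /compatP cB].
  apply/eqP/ffunP => a; rewrite ffunE; case: ifPn => Pa.
    by have := cB (inl a); rewrite B1 // bd_oneE.
  by have := cA (inl a); rewrite A1 // bd_oneE.
set j0 := finfun _ => /=.
have eA x : P (strand x) -> bcolour i j0 x = bcolour i k x.
  by case: x => a //= Pa; rewrite ffunE Pa.
have eB x : ~~ P (strand x) -> bcolour j0 k x = bcolour i k x.
  by case: x => a //= Pa; rewrite ffunE (negbTE Pa).
have DP x : P (strand (D x)) = P (strand x).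
  rewrite DE; case: ifPn => Px; last by rewrite one_on_strand // (negbTE Px).
  by have /negb_inj -> := @one_on_strand _ _ x A1.
apply/andP/compatP => [[/compatP cA /compatP cB] x|cD].
  have := DP x; rewrite DE; case: ifPn => Px DPx.
    by rewrite -!eA ?cA ?DPx.
  by rewrite -!eB ?cB ?DPx.
split; apply/compatP => x.
  case: (boolP (P (strand x))) => Px.
    by have := cD x; have := DP x; rewrite DE Px => PA; rewrite !eA ?PA.
  rewrite A1 // bd_oneE; move: Px; case: x => a /= Pa;
    by rewrite ffunE (negbTE Pa).
case: (boolP (P (strand x))) => Px.
  rewrite B1 // bd_oneE; move: Px; case: x => a /= Pa; by rewrite ffunE Pa.
by have := cD x; have := DP x; rewrite DE (negbTE Px) => PA; rewrite !eB ?PA.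
Qed.

Definition bd_as_perm D : {perm bvertex n} := perm (inv_inj (bd_invol D)).

Lemma bd_as_permE D x : bd_as_perm D x = D x.
Proof. by rewrite permE. Qed.

Lemma bd_as_permV D : ((bd_as_perm D)^-1)%g = bd_as_perm D.
Proof.
apply/permP => x; apply: (@perm_inj _ (bd_as_perm D)).
by rewrite permKV !bd_as_permE bd_invol.
Qed.

(** Exchange of the two rows, an anti-automorphism of the composition. *)
Definition bd_flip D := bd_conj (bd_as_perm (bd_one n)) D.

Lemma bd_flipE D x : bd_flip D x = bd_one n (D (bd_one n x)).
Proof. by rewrite bd_conjE bd_as_permV !bd_as_permE. Qed.

Lemma bd_flipK : involutive bd_flip.
Proof. by move=> D; apply: bdiagP => x; rewrite !bd_flipE !bd_invol. Qed.

Lemma compat_flip D (i k : colouring) : compat (bd_flip D) i k = compat D k i.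
Proof.
by apply: compat_conj => x; rewrite bd_as_permE bd_oneE; case: x.
Qed.

Lemma bd_comp_flip A B :
  bd_loops (bd_flip B) (bd_flip A) = bd_loops A B /\
  bd_comp (bd_flip B) (bd_flip A) = bd_flip (bd_comp A B).
Proof.
apply: compat_eq => i k; rewrite compat_flip -!card_compat_sum.
by apply: eq_bigr => j _; rewrite !compat_flip mulnC.
Qed.

(** The diagram with edges p q in both rows and all other edges vertical. *)
Definition bd_cap (p q : 'I_n) : bdiag n :=
  bd_conj (tperm (inl p) (inr q)) (bd_one n).

Lemma bd_capE (p q : 'I_n) x : p != q -> bd_cap p q x =
  match x with
  | inl a => if a == p then inl q else if a == q then inl p else inr a
  | inr a => if a == p then inr q else if a == q then inr p else inl a
  end.
Proof.
move=> pq; rewrite bd_conjE tpermV.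
have inlE (a b : 'I_n) : ((inl a : bvertex n) == inl b) =
  (a == b) by apply: (inj_eq inl_inj).
have inrE (a b : 'I_n) : ((inr a : bvertex n) == inr b) =
  (a == b) by apply: (inj_eq inr_inj).
case: x => a /=.
  have [->|ap] := eqVneq a p; first by rewrite tpermL bd_oneE tpermD // inlE.
  rewrite (tpermD (z := inl a)) ?inlE 1?eq_sym // bd_oneE.
  have [->|aq] := eqVneq a q; first by rewrite tpermR.
  by rewrite tpermD // inrE eq_sym.
have [->|ap] := eqVneq a p.
  by rewrite (tpermD (z := inr p)) ?inrE 1?eq_sym // bd_oneE tpermL.
have [->|aq] := eqVneq a q;
  first by rewrite tpermR bd_oneE tpermD // inrE eq_sym.
rewrite (tpermD (z := inr a)) ?inrE 1?eq_sym // bd_oneE.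
by rewrite tpermD // inlE eq_sym.
Qed.

(** A cap lifts a bottom vertex to the top: in the left factor, the vertex p of
the bottom row carries the edge that [D] has at the top vertex t, while t is
joined to the bottom vertex q. The upper edge p q of the cap leads this edge
back up to t, and its lower edge restores the edge p q of [D]. *)
Lemma bd_comp_capr D (p q t : 'I_n) : D (inr p) = inr q ->
  bd_loops (bd_conj (tperm (inl t) (inr p)) D) (bd_cap p q) = 0%N /\
  bd_comp (bd_conj (tperm (inl t) (inr p)) D) (bd_cap p q) = D.
Proof.
move=> Dp; have Dq : D (inr q) = inr p by rewrite -Dp bd_invol.
have pq : p != q.
  by have := bd_neq D (inr p); rewrite Dp (inj_eq inr_inj) eq_sym.
set A := bd_conj _ D.
have At : A (inl t) = inr q.
  rewrite /A bd_conjE tpermV tpermL Dp.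
  by rewrite tpermD // (inj_eq inr_inj).
have cC (i j k : colouring) : (forall a, a != p -> a != q -> j a = k a) ->
    j p = j q -> k p = k q -> compat D i j -> compat D i k.
  move=> jk jpq kpq /compatP c; apply/compatP => x.
  have e y : y != inr p -> y != inr q -> bcolour i k y = bcolour i j y.
    by case: y => // a; rewrite !(inj_eq inr_inj) => *; rewrite /= jk.
  have [->|xp] := eqVneq x (inr p); first by rewrite Dp.
  have [->|xq] := eqVneq x (inr q); first by rewrite Dq.
  have Dxp : D x != inr p by rewrite -Dq (inj_eq (inv_inj (bd_invol D))).
  have Dxq : D x != inr q by rewrite -Dp (inj_eq (inv_inj (bd_invol D))).
  by rewrite !e.
have cA (i j : colouring) : j p = i t -> compat A i j = compat D i j.
  move=> e; apply: compat_conj => x; case: tpermP => [->|->|] //=.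
apply: bd_comp_by_colouring => i k;
  exists [ffun a => if a \in [:: p; q] then i t else k a] => j.
set j0 := finfun _.
have j0p : j0 p = i t by rewrite ffunE inE eqxx.
have j0q : j0 q = i t by rewrite ffunE !inE eqxx orbT.
have j0k a : a != p -> a != q -> j0 a = k a.
  by move=> /negbTE ap /negbTE aq; rewrite ffunE !inE ap aq.
apply/andP/andP => [[c /compatP cap]|[/eqP -> c]].
  have jpq : j p = j q by have := cap (inl q);
    rewrite bd_capE // eqxx eq_sym (negbTE pq).
  have kpq : k p = k q by have := cap (inr q);
    rewrite bd_capE // eqxx eq_sym (negbTE pq).
  have jk a : a != p -> a != q -> j a = k a.
    by move=> /negbTE ap /negbTE aq; have := cap (inl a);
      rewrite bd_capE // ap aq.
  have jt : j p = i t by have /compatP/(_ (inl t)) := c; rewrite At jpq.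
  split.
    apply/eqP/ffunP => a; have [->|ap] := eqVneq a p; first by rewrite j0p.
    have [->|aq] := eqVneq a q; first by rewrite j0q -jpq.
    by rewrite j0k // jk.
  by rewrite cA // in c; apply: cC c.
have kpq : k p = k q by have /compatP/(_ (inr q)) := c; rewrite Dq.
split.
  by rewrite cA //; apply: cC c => //; [move=> *; rewrite j0k|rewrite j0p j0q].
apply/compatP => x; rewrite bd_capE //; case: x => a /=.
  have [->|ap] := eqVneq a p; first by rewrite /= j0p j0q.
  have [->|aq] := eqVneq a q; first by rewrite /= j0p j0q.
  by rewrite /= j0k.
have [->|ap] := eqVneq a p; first by [].
have [->|aq] := eqVneq a q; first by [].
by rewrite /= j0k.
Qed.

Lemma bd_comp_capl D (p q t : 'I_n) : D (inl p) = inl q ->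
  bd_loops (bd_flip (bd_cap p q)) (bd_conj (tperm (inr t) (inl p)) D) = 0%N /\
  bd_comp (bd_flip (bd_cap p q)) (bd_conj (tperm (inr t) (inl p)) D) = D.
Proof.
move=> Dp.
have Fp : bd_flip D (inr p) =
  inr q by rewrite bd_flipE [bd_one n (inr p)]bd_oneE Dp bd_oneE.
have [] := bd_comp_capr t Fp.
rewrite -(bd_flipK (bd_conj (tperm (inr t) _) D)).
have -> : bd_flip (bd_conj (tperm (inr t) (inl p)) D) =
          bd_conj (tperm (inl t) (inr p)) (bd_flip D).
  rewrite /bd_flip -!bd_conjM; congr bd_conj.
  rewrite conjgC; congr (_ * _)%g.
  by rewrite tpermJ !bd_as_permE !bd_oneE.
set A := bd_conj _ (bd_flip D) => e1 e2.
by have [-> ->] := bd_comp_flip A (bd_cap p q); rewrite e1 e2 bd_flipK.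
Qed.

Lemma bd_e_cap (j : 'I_n.-1) : bd_e j = bd_cap (adjl j) (adjr j).
Proof.
apply: bdiagP => x; rewrite bd_capE ?adj_neq // mk_bdiagE.
case: x => a /=; rewrite /sperm.
  have [->|ap] := eqVneq a (adjl j); first by rewrite tpermL.
  by have [->|aq] := eqVneq a (adjr j); first by rewrite tpermR.
have [->|ap] := eqVneq a (adjl j); first by rewrite tpermL.
by have [->|aq] := eqVneq a (adjr j); first by rewrite tpermR.
Qed.

Definition adj (j : 'I_n.-1) (a : 'I_n) := (a == adjl j) || (a == adjr j).

(** The exchange of the two named vertices turns two adjacent vertical edges
into the two horizontal edges of [bd_e j]. *)
Lemma bd_conj_el (j : 'I_n.-1) D x : one_on (adj j) D ->
  bd_conj (tperm (inl (adjl j)) (inr (adjr j))) D x =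
    if adj j (strand x) then bd_e j x else D x.
Proof.
move=> D1; case: ifPn => Px.
  rewrite bd_e_cap !bd_conjE D1 // tpermV.
  by case: tpermP => [| |_ _] //= _; rewrite /adj eqxx ?orbT.
have fix_off y : ~~ adj j (strand y) -> tperm (inl (adjl j)) (inr (adjr j)) y =
  y.
  rewrite negb_or; case: y => a /= /andP[al ar];
  by rewrite tpermD //= ?(inj_eq inl_inj) ?(inj_eq inr_inj) // eq_sym.
rewrite bd_conjE tpermV [tperm _ _ x]fix_off // fix_off //.
by rewrite one_on_strand.
Qed.

Lemma bd_comp_el (j : 'I_n.-1) D : one_on (adj j) D ->
  bd_loops (bd_e j) D = 0%N /\
  bd_comp (bd_e j) D = bd_conj (tperm (inl (adjl j)) (inr (adjr j))) D.
Proof.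
move=> D1; apply: (@bd_comp_union (adj j)) => // [x|x]; last exact: bd_conj_el.
rewrite bd_e_cap bd_capE ?adj_neq // bd_oneE /= negb_or.
by case: x => a /andP[/= /negbTE al /negbTE ar]; rewrite al ar.
Qed.

End Conj.

(** * The sign of a diagram *)

Section Chi.
Variable n : nat.
Implicit Types (D A B : bdiag n) (p q : {perm bvertex n}) (w : 'S_n).

Lemma top_perm1 : top_perm 1%g = 1%g :> {perm bvertex n}.
Proof. by apply/permP => -[] i; rewrite rowpE !perm1. Qed.

Lemma top_permM w1 w2 : top_perm (w1 * w2)%g = (top_perm w1 * top_perm w2)%g.
Proof. by apply/permP => -[] i; rewrite !permM !rowpE ?permM. Qed.

Lemma top_tperm (i j : 'I_n) : top_perm (tperm i j) = tperm (inl i) (inl j).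
Proof.
apply/permP => -[] k; rewrite rowpE; last by rewrite tpermD.
by rewrite (inj_tperm _ _ _ inl_inj).
Qed.

Lemma odd_top_perm w : odd_perm (top_perm w) = odd_perm w.
Proof.
have [ts -> tsP] := prod_tpermP w; elim: ts tsP => [|t ts IHts] /=.
  by move=> _; rewrite !big_nil top_perm1 !odd_perm1.
case/andP=> tP /IHts e; rewrite !big_cons top_permM !odd_permM e top_tperm.
by rewrite !odd_tperm (inj_eq inl_inj).
Qed.

Lemma bot_perm_conj w : bot_perm w = (top_perm w ^ bd_as_perm (bd_one n))%g.
Proof.
apply/permP => x; rewrite -[x](permKV (bd_as_perm (bd_one n))) permJ.
by rewrite bd_as_permV !bd_as_permE; case: x => i; rewrite !(bd_oneE, rowpE).
Qed.

Lemma odd_bot_perm w : odd_perm (bot_perm w) = odd_perm w.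
Proof. by rewrite bot_perm_conj odd_permJ odd_top_perm. Qed.

(** Edges are oriented along a linear order of the vertices in which the top row
comes first and both rows run from right to left: [rev_edge x y] says that y
precedes x. For this order the Pfaffian sign of a diagram is [bd_sign], with its
factor (-1) ^ f, and the identity diagram is positive. *)
Definition rev_edge (x y : bvertex n) : bool :=
  match x, y with
  | inl i, inr j => false
  | inr i, inl j => true
  | inl i, inl j | inr i, inr j => i < j
  end%N.

Lemma rev_edgeC x y : x != y -> rev_edge y x = ~~ rev_edge x y.
Proof.
case: x y => i [] j //=; rewrite ?(inj_eq inl_inj) ?(inj_eq inr_inj).
  by rewrite -val_eqE -leqNgt ltn_neqAle eq_sym => ->.
by rewrite -val_eqE -leqNgt ltn_neqAle eq_sym => ->.
Qed.

Definition edge_sign (x y : bvertex n) : int := (-1) ^+ rev_edge x y.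

(** The sign of the term of a Pfaffian that is listed by [p]: the matching has
the edges {p (inl i), p (inr i)}. *)
Definition chi p : int :=
  (-1) ^+ odd_perm p * \prod_i edge_sign (p (inl i)) (p (inr i)).

Lemma edge_signC x y : x != y -> edge_sign y x = - edge_sign x y.
Proof. by move=> xy; rewrite /edge_sign rev_edgeC //; case: rev_edge. Qed.

Lemma chi_swap i p : chi (tperm (inl i) (inr i) * p) = chi p.
Proof.
rewrite /chi odd_mul_tperm /= (bigD1 i) //= [in RHS](bigD1 i) //=.
rewrite !permM tpermL tpermR edge_signC ?(inj_eq perm_inj) //.
rewrite signrN !(mulNr, mulrN) opprK; congr (_ * (_ * _)).
apply: eq_bigr => j ji; rewrite !permM !tpermD //=
  ?(inj_eq inl_inj) ?(inj_eq inr_inj) //.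
- by rewrite eq_sym.
- by rewrite eq_sym.
Qed.

Lemma chi_diag w p : chi (top_perm w * bot_perm w * p) = chi p.
Proof.
rewrite /chi !odd_permM odd_top_perm odd_bot_perm addbb addFb; congr (_ * _).
rewrite [RHS](reindex_perm w) /=; apply: eq_bigr => i _.
by rewrite !permM !rowpE.
Qed.

(** The centralizer of the identity matching is generated by the exchanges of
the two ends of an edge, which change both the parity and one edge orientation,
and by the permutations of the edges, which are even. The induction removes the
exchanges one at a time. *)
Lemma chi_centralizer q p :
  bd_conj q (bd_one n) = bd_one n -> chi (q * p) = chi p.
Proof.
have [k] := ubnP #|[set i | ~~ (if q (inl i) is inl _ then true else false)]|.
elim: k q => // k IHk q; rewrite ltnS => lek q1.
have qE x : bd_one n (q x) = q (bd_one n x) by rewrite -{1}q1 bd_conj_apply.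
have qr i : q (inr i) = bd_one n (q (inl i)).
  by rewrite qE [bd_one n (inl i)]bd_oneE.
have [i|allt] := pickP [pred i | ~~
  (if q (inl i) is inl _ then true else false)].
  move=> /= qi; rewrite -(chi_swap i) mulgA; apply: IHk; last first.
    apply: bd_conj_eq => x; rewrite !permM qE; congr (q _).
    case: tpermP => [->|->|/eqP xi /eqP xi'].
    - by rewrite !bd_oneE tpermR.
    - by rewrite !bd_oneE tpermL.
    case: x xi xi' => a; rewrite bd_oneE ?(inj_eq inl_inj) ?(inj_eq inr_inj)
      => *; by rewrite tpermD // ?(inj_eq inl_inj) ?(inj_eq inr_inj) // eq_sym.
  apply: leq_trans lek; apply/proper_card/properP; split.
    apply/subsetP => j; rewrite !inE permM.
    have [->|ji] := eqVneq j i.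
      by rewrite tpermL qr; case: (q (inl i)) qi => // a; rewrite bd_oneE.
    by rewrite tpermD // (inj_eq inl_inj) eq_sym.
  exists i; rewrite !inE // permM tpermL negbK.
  by rewrite qr; case: (q (inl i)) qi => // a; rewrite bd_oneE.
have qt i : exists j, q (inl i) = inl j.
  by have := allt i; rewrite /=; case: (q (inl i)) => a //= _; exists a.
pose f i := odflt i [pick j | q (inl i) == inl j].
have fE i : q (inl i) = inl (f i).
  rewrite /f; case: pickP => [j /eqP //|/=].
  by have [j ->] := qt i => /(_ j); rewrite eqxx.
have f_inj : injective f.
  move=> i j e; have: q (inl i) = q (inl j) by rewrite !fE e.
  by move=> /perm_inj[].
have -> : q = (top_perm (perm f_inj) * bot_perm (perm f_inj))%g.
  apply/permP => -[] i; rewrite permM !rowpE permE ?fE //.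
  by rewrite qr fE bd_oneE.
exact: chi_diag.
Qed.

(** A matching therefore has a well-defined Pfaffian sign, whatever the listing
of its edges. *)
Lemma chi_conj p q :
  bd_conj p (bd_one n) = bd_conj q (bd_one n) -> chi p = chi q.
Proof.
move=> e; rewrite -[p](mulgKV q); apply: chi_centralizer.
by rewrite bd_conjM e -bd_conjM mulgV bd_conj1.
Qed.

Lemma odd_sperm (j : 'I_n.-1) : odd_perm (sperm j) = true.
Proof. by rewrite odd_tperm adj_neq. Qed.

(** A shortest word is in particular a word in transpositions. *)
Lemma perm_length_sign w : (-1) ^+ perm_length w = (-1) ^+ odd_perm w :> int.
Proof.
rewrite /perm_length; case: ex_minnP => k /existsP[t /eqP -> _].
suff -> : odd_perm (\prod_(j <- t) sperm j)%g = odd k by rewrite signr_odd.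
rewrite -{2}(size_tuple t); elim: (tval t) => [|j s IHs].
  by rewrite big_nil odd_perm1.
by rewrite big_cons odd_permM odd_sperm IHs.
Qed.

Definition e_seq (f : nat) : seq 'I_n.-1 :=
  [seq j <- enum 'I_n.-1 | ~~ odd (j : 'I_n.-1) && (j < f.*2)%N].

Definition e_fold js : bdiag n :=
  foldr (@bd_comp n) (bd_one n) [seq bd_e j | j <- js].

Lemma bd_e_oddE f : bd_e_odd n f = e_fold (e_seq f). Proof. by []. Qed.

Definition touched (js : seq 'I_n.-1) (a : 'I_n) := has (fun j => adj j a) js.

(** Indices whose generators e_j touch pairwise disjoint strands; those that
occur in [bd_e_odd] are of this form. *)
Definition even_seq (js : seq 'I_n.-1) :=
  uniq js && all (fun j : 'I_n.-1 => ~~ odd j) js.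

Lemma even_adj (i j : 'I_n.-1) a :
  ~~ odd i -> ~~ odd j -> adj i a -> adj j a -> i = j.
Proof.
move=> ei ej /orP[] /eqP-> /orP[] /eqP/(congr1 val) /= e; apply: val_inj => //=.
- by rewrite e /= ej in ei.
- by rewrite -e /= ei in ej.
- by case: e.
Qed.

Lemma touched_cons j js :
  even_seq (j :: js) -> forall a, adj j a -> ~~ touched js a.
Proof.
move=> /andP[/= /andP[jjs _] /andP[ej /allP ejs]] a ja; apply/hasPn => i ijs.
by apply: contraNN jjs => ia; rewrite (even_adj ej (ejs i ijs) ja ia).
Qed.

Lemma even_seq_cons j js : even_seq (j :: js) -> even_seq js.
Proof. by move=> /andP[/= /andP[_ u] /andP[_ e]]; apply/andP. Qed.

Lemma e_fold_one js :
  even_seq js -> one_on (fun a => ~~ touched js a) (e_fold js).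
Proof.
elim: js => [|j js IHjs] ok x //=; rewrite negb_or => /andP[jx jsx].
have := IHjs (even_seq_cons ok); rewrite -/(e_fold js) => D1.
have one : one_on (adj j) (e_fold js).
  by move=> y /(touched_cons ok); apply: D1.
rewrite -[LHS]/(bd_comp (bd_e j) (e_fold js) x).
by have [_ ->] := bd_comp_el one; rewrite bd_conj_el // (negbTE jx) D1.
Qed.

Lemma e_fold_cons j js : even_seq (j :: js) ->
  one_on (adj j) (e_fold js) /\ bd_loops (bd_e j) (e_fold js) = 0%N /\
  e_fold (j :: js) = bd_conj (tperm (inl (adjl j)) (inr (adjr j))) (e_fold js).
Proof.
move=> ok; have one : one_on (adj j) (e_fold js).
  by move=> y /(touched_cons ok); apply/e_fold_one/(even_seq_cons ok).
by have [? ?] := bd_comp_el one.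
Qed.

Lemma e_fold_touched js j x : even_seq js -> j \in js -> adj j (strand x) ->
  e_fold js x = bd_e j x.
Proof.
elim: js => // i js IHjs ok; rewrite inE => ijs jx.
have [one [_ ->]] := e_fold_cons ok; rewrite bd_conj_el //.
have [<-|ij] := eqVneq j i; first by rewrite jx.
rewrite (negbTE ij) /= in ijs; case: ifP => [ix|_]; last first.
  by apply: IHjs => //; apply: even_seq_cons ok.
by have /hasPn/(_ j ijs) := touched_cons ok ix; rewrite jx.
Qed.

Lemma e_seq_even f : even_seq (e_seq f).
Proof.
rewrite /even_seq filter_uniq ?enum_uniq //=; apply/allP => j.
by rewrite mem_filter => /andP[/andP[]].
Qed.

Lemma mem_e_seq f (j : 'I_n.-1) : (j \in e_seq f) = ~~ odd j && (j < f.*2)%N.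
Proof. by rewrite mem_filter mem_enum andbT. Qed.

End Chi.

Section Sign.
Variable n : nat.
Implicit Types (D A B : bdiag n) (p q : {perm bvertex n}) (w : 'S_n).

(** The edges of a product of commuting e_j, listed so that the horizontal ones
run from right to left, hence along the orientation of [rev_edge]. *)
Definition edge_shape (js : seq 'I_n.-1) (x y : bvertex n) : Prop :=
  [\/ exists i, x = inl i /\ y = inr i,
      exists2 j, j \in js & x = inl (adjr j) /\ y = inl (adjl j)
    | exists2 j, j \in js & x = inr (adjr j) /\ y = inr (adjl j)].

(** Each e_j contributes one transposition, so that a product of f of them has a
listing of the parity of f. *)
Lemma e_fold_conj js : even_seq js -> exists p,
  [/\ e_fold js = bd_conj p (bd_one n), odd_perm p = odd (size js) &
      forall i, edge_shape js (p (inl i)) (p (inr i))].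
Proof.
elim: js => [|j js IHjs] ok.
  exists 1%g; split; rewrite ?bd_conj1 ?odd_perm1 // => i.
  by constructor 1; exists i; rewrite !perm1.
have [p [e op sh]] := IHjs (even_seq_cons ok).
exists (p * tperm (inl (adjl j)) (inr (adjr j)))%g; split.
- by have [_ [_ ->]] := e_fold_cons ok; rewrite e bd_conjM.
- by rewrite odd_permM odd_tperm op /= addbT.
have off k a : k \in js -> adj j a -> a != adjl k /\ a != adjr k.
  by move=> kjs ja; have /hasPn/(_ k kjs) := touched_cons ok ja;
    rewrite negb_or => /andP.
move=> i; rewrite !permM;
  case: (sh i) => [[a [-> ->]]|[k kjs [-> ->]]|[k kjs [-> ->]]].
- have [->|al] := eqVneq a (adjl j).
    constructor 3; exists j; rewrite ?mem_head // tpermL tpermD //.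
    by rewrite (inj_eq inr_inj) eq_sym adj_neq.
  have [->|ar] := eqVneq a (adjr j).
    constructor 2; exists j; rewrite ?mem_head // tpermR tpermD //.
    by rewrite (inj_eq inl_inj) adj_neq.
  constructor 1; exists a; rewrite !tpermD ?(inj_eq inl_inj) ?(inj_eq inr_inj)
    //.
    by rewrite eq_sym.
  by rewrite eq_sym.
- constructor 2; exists k; first by rewrite inE kjs orbT.
  have [//|l r] := off k (adjl j) kjs; first by rewrite /adj eqxx.
  by rewrite !tpermD ?(inj_eq inl_inj).
constructor 3; exists k; first by rewrite inE kjs orbT.
have [//|l r] := off k (adjr j) kjs; first by rewrite /adj eqxx orbT.
by rewrite !tpermD ?(inj_eq inr_inj).
Qed.

Lemma size_e_seq f : (f.*2 <= n)%N -> size (e_seq n f) = f.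
Proof.
move=> fn; rewrite -(size_map val).
have /perm_size-> : perm_eq [seq val i | i <- e_seq n f]
  [seq i.*2 | i <- iota 0 f].
  apply: uniq_perm => [||k].
  - by rewrite (map_inj_uniq val_inj) filter_uniq ?enum_uniq.
  - by rewrite (map_inj_uniq double_inj) iota_uniq.
  apply/mapP/mapP => [[j]|[i]].
    rewrite mem_e_seq => /andP[ej jf] ->; exists j./2; rewrite ?even_halfK //.
    by rewrite mem_iota /= ltn_half_double.
  rewrite mem_iota /= add0n => lti ->.
  have ltn1 : (i.*2 < n.-1)%N.
    rewrite ltn_predRL; apply: leq_trans fn.
    by rewrite -doubleS leq_double.
  by exists (Ordinal ltn1); rewrite // mem_e_seq /= odd_double ltn_double.
by rewrite size_map size_iota.
Qed.

Lemma bd_factors_conj D f d1 d2 s : bd_factors D (f, d1, d2, s) ->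
  D = bd_conj (top_perm d1 * bot_perm s * bot_perm d2) (bd_e_odd n f).
Proof.
move=> /and4P[_ _ _ /eqP->].
have [_ ->] := bd_comp_perml d1^-1 (bd_e_odd n f).
have [_ ->] := bd_comp_permr s (bd_conj (top_perm d1^-1^-1) (bd_e_odd n f)).
by rewrite (bd_comp_permr _ _).2 !bd_conjM invgK.
Qed.

Lemma half_double_le (f : 'I_(n./2).+1) : (f.*2 <= n)%N.
Proof.
have := ltn_ord f; rewrite ltnS -leq_double => /leq_trans; apply.
by rewrite -{2}(odd_double_half n) leq_addl.
Qed.

(** The product of the factorization relabels the edges of e_1 e_3 ... by d1
above and by s d2 below. Since s fixes the horizontal part and d1, d2 increase
along each pair, the listing of [e_fold_conj] keeps all its edges well oriented,
and only the parities of the permutations remain. *)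
Lemma bd_factors_sign D (f : 'I_(n./2).+1) d1 d2 s q :
  bd_factors D (f, d1, d2, s) -> D = bd_conj q (bd_one n) ->
  (-1) ^+ f * (-1) ^+ (perm_length d1 + perm_length d2 + perm_length s) = chi q.
Proof.
move=> fD Dq; have De := bd_factors_conj fD.
have [p [ep op sh]] := e_fold_conj (e_seq_even n f).
rewrite size_e_seq ?half_double_le // in op.
move: De; rewrite bd_e_oddE ep -bd_conjM Dq => /chi_conj ->.
case/and4P: fD => d1P d2P sP _.
rewrite /chi big1 ?mulr1 => [|i _].
  rewrite !odd_permM op odd_top_perm !odd_bot_perm !exprD !perm_length_sign.
  rewrite -[(-1) ^+ f]signr_odd.
  by case: (odd f); case: (odd_perm d1); case: (odd_perm d2);
    case: (odd_perm s).
rewrite /edge_sign !permM; case: (sh i).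
- by case=> a [-> ->]; rewrite !rowpE.
- case=> j; rewrite mem_e_seq => /andP[ej jf] [-> ->]; rewrite !rowpE /=.
  have := d1P; rewrite inE => /forallP/(_ (adjl j))/forallP/(_ (adjr j)).
  by rewrite /= ej jf eqxx => /and3P[+ _ _] => /= lt; rewrite ltnNge ltnW.
case=> j; rewrite mem_e_seq => /andP[ej jf] [-> ->]; rewrite !rowpE /=.
have fixs (a : 'I_n) : (a < f.*2)%N -> s a = a.
  by move=> af; apply: (out_perm sP); rewrite inE -ltnNge.
rewrite !fixs //; last first.
  by rewrite /= ltn_neqAle jf andbT; apply: contraNneq ej => e;
    have := odd_double f; rewrite -e /= => /negbFE.
have := d2P; rewrite inE => /forallP/(_ (adjl j))/forallP/(_ (adjr j)).
by rewrite /= ej jf eqxx => /and3P[+ _ _] => /= lt; rewrite ltnNge ltnW.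
Qed.

End Sign.

(** * Every diagram has a factorization *)

Section Listing.
Variable n : nat.

Fact list_perm_inj (l : seq 'I_n) : uniq l -> size l = n ->
  injective (fun k : 'I_n => nth k l k).
Proof.
move=> ul sl i j /= e; apply: val_inj; apply/eqP.
have lt (k : 'I_n) : (k < size l)%N by rewrite sl.
by rewrite -(nth_uniq i (lt i) (lt j) ul) e (set_nth_default i).
Qed.

Definition list_perm l (ul : uniq l) (sl : size l = n) : 'S_n :=
  perm (list_perm_inj ul sl).

Lemma list_permE l ul sl (x0 i : 'I_n) : @list_perm l ul sl i = nth x0 l i.
Proof. by rewrite permE (set_nth_default x0) ?sl. Qed.

Lemma nth_flatten_pairs (g : 'I_n -> 'I_n) s x0 k : (k < size s)%N ->
  let l := flatten [seq [:: a; g a] | a <- s] in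
  nth x0 l k.*2 = nth x0 s k /\ nth x0 l k.*2.+1 = g (nth x0 s k).
Proof. by elim: s k => //= a s IHs [|k] //= /IHs. Qed.

Lemma size_flatten_pairs (g : 'I_n -> 'I_n) s :
  size (flatten [seq [:: a; g a] | a <- s]) = (size s).*2.
Proof. by elim: s => //= a s ->. Qed.

Lemma sorted_filter_enum (P : pred 'I_n) (x0 : 'I_n) i j :
  let s := [seq a <- enum 'I_n | P a] in
  (i < j)%N -> (j < size s)%N -> (nth x0 s i < nth x0 s j)%N.
Proof.
move=> s ij js.
have srt : sorted (relpre val ltn) s.
  apply: sorted_filter; first by move=> y x z /=; apply: ltn_trans.
  by rewrite -sorted_map val_enum_ord iota_ltn_sorted.
apply: (@sorted_ltn_nth _ (relpre val ltn) _ x0 s srt) => //.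
- by move=> y x z /=; apply: ltn_trans.
- by rewrite inE (ltn_trans ij).
Qed.

(** A distinguished permutation lists first the pairs {a, pi a}, each from its
smaller element and by increasing smaller elements, and then the fixed points in
increasing order. *)
Lemma dset_ex (pi : 'I_n -> 'I_n) : involutive pi ->
  exists f, exists2 d : 'S_n, d \in dset n f &
   [/\ (f.*2 + #|[pred a : 'I_n | pi a == a]| = n)%N,
       forall i j : 'I_n, ~~ odd i -> (i < f.*2)%N -> j = i.+1 :> nat ->
         pi (d i) = d j
     & forall i : 'I_n, (f.*2 <= i)%N -> pi (d i) = d i].
Proof.
move=> piK.
pose tops := [seq a : 'I_n <- enum 'I_n | (a < pi a)%N].
pose fixed := [seq a <- enum 'I_n | pi a == a].
pose l := flatten [seq [:: a; pi a] | a <- tops] ++ fixed.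
have szF : size fixed = #|[pred a : 'I_n | pi a == a]|
  by rewrite size_filter -sum1_count big_enum_cond -sum1_card; apply: eq_bigl.
(* An element is smaller than, larger than or equal to its image; the first
   two kinds are exchanged by pi. *)
have szT : ((size tops).*2 + size fixed = n)%N.
  have splitn : (\sum_(a : 'I_n) ((a < pi a) + (pi a < a) + (pi a == a)) = n)%N.
    rewrite -[RHS]card_ord -sum1_card; apply: eq_bigr => a _.
    by rewrite -val_eqE; case: ltngtP.
  rewrite !big_split /= in splitn; rewrite -[RHS]splitn.
  have cnt (P : pred 'I_n) : size [seq a <- enum 'I_n | P a] = (\sum_a (P a))%N.
    by rewrite size_filter -sum1_count big_mkcond big_enum.
  rewrite !cnt -addnn; congr (_ + _ + _)%N.
  by rewrite (reindex_inj (inv_inj piK)); apply: eq_bigr => a _; rewrite piK.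
have szl : size l = n by rewrite size_cat size_flatten_pairs.
have lP a : a \in l.
  rewrite mem_cat; have [e|ne] := eqVneq (pi a) a.
    by rewrite [a \in fixed]mem_filter e eqxx mem_enum orbT.
  apply/orP; left; apply/flattenP.
  have [lt|ge] := ltnP a (pi a).
    by exists [:: a; pi a]; rewrite ?mem_head //; apply/mapP; exists a;
      rewrite // mem_filter lt mem_enum.
  exists [:: pi a; a]; rewrite ?inE ?eqxx ?orbT //; apply/mapP.
  exists (pi a); last by rewrite piK.
  by rewrite mem_filter mem_enum piK andbT ltn_neqAle ge val_eqE ne.
have ul : uniq l.
  apply: (@leq_size_uniq _ (enum 'I_n)); rewrite ?enum_uniq //.
  by rewrite szl size_enum_ord.
have nth_even x0 k : (k < size tops)%N -> nth x0 l k.*2 = nth x0 tops k.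
  move=> kT; have [<- _] := nth_flatten_pairs pi x0 kT.
  by rewrite nth_cat size_flatten_pairs ltn_double kT.
have nth_odd x0 k : (k < size tops)%N -> nth x0 l k.*2.+1 = pi (nth x0 tops k).
  move=> kT; have [_ <-] := nth_flatten_pairs pi x0 kT.
  by rewrite nth_cat size_flatten_pairs -doubleS leq_double kT.
have nth_fix x0 k : ((size tops).*2 <= k)%N -> nth x0 l k =
  nth x0 fixed (k - (size tops).*2).
  by move=> kT; rewrite nth_cat size_flatten_pairs ltnNge kT.
have evE (i : 'I_n) : ~~ odd i -> nat_of_ord i = i./2.*2.
  by move=> ei; rewrite even_halfK.
have evlt (i : 'I_n) : (i < (size tops).*2)%N -> (i./2 < size tops)%N.
  by move=> lti; rewrite ltn_half_double.
exists (size tops); exists (list_perm ul szl).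
  rewrite inE; apply/forallP => i; apply/forallP => j;
    rewrite !(list_permE _ _ i).
  apply/and3P; split; apply/implyP.
  - move=> /and3P[ei lti /eqP->]; rewrite (evE i ei) nth_even ?nth_odd ?evlt //.
    have : nth i tops i./2 \in tops by rewrite mem_nth ?evlt.
    by rewrite mem_filter => /andP[].
  - move=> /and3P[ei ltj /eqP ej].
    have sT : (i./2.+1 < size tops)%N by rewrite -ltn_double doubleS -(evE i ei)
      -ej.
    rewrite ej (evE i ei) -doubleS !nth_even ?(ltnW sT) //.
    exact: sorted_filter_enum.
  move=> /andP[lei ltij]; rewrite !nth_fix ?(leq_trans lei) ?(ltnW ltij) //.
  apply: sorted_filter_enum; first by rewrite ltn_sub2r // (leq_ltn_trans lei).
  by rewrite ltn_subLR ?szT //; apply: leq_trans lei (ltnW ltij).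
split; first by rewrite -szF.
- move=> i j ei lti ej; rewrite !(list_permE _ _ i) ej (evE i ei).
  by rewrite nth_even ?nth_odd ?evlt.
move=> i gei; rewrite !(list_permE _ _ i) nth_fix //.
suff : nth i fixed (i - (size tops).*2) \in fixed by rewrite mem_filter =>
  /andP[/eqP].
by rewrite mem_nth // ltn_subLR // szT.
Qed.

End Listing.

Section Factorization.
Variable n : nat.
Implicit Types (D A B : bdiag n) (p q : {perm bvertex n}) (w : 'S_n).

(** An involution of the row; the vertices of through edges become fixed points.
*)
Definition top_mate D (a : 'I_n) : 'I_n := if D (inl a) is inl b then b else a.

Lemma top_mateK D : involutive (top_mate D).
Proof.
move=> a; rewrite /top_mate; case e: (D (inl a)) => [b|b]; last by rewrite e.
by rewrite -e bd_invol.
Qed.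

Lemma top_mateP D a :
  if top_mate D a == a then exists b, D (inl a) = inr b
  else D (inl a) = inl (top_mate D a).
Proof.
rewrite /top_mate; have := bd_neq D (inl a); case e: (D (inl a)) => [b|b].
  by rewrite (inj_eq inl_inj) => /negbTE->.
by rewrite eqxx => _; exists b.
Qed.

Lemma bot_mateP D a :
  if top_mate (bd_flip D) a == a then exists b, D (inr a) = inl b
  else D (inr a) = inr (top_mate (bd_flip D) a).
Proof.
have DE x : D x = bd_one n (bd_flip D (bd_one n x)) by rewrite bd_flipE
  !bd_invol.
have := top_mateP (bd_flip D) a; rewrite DE [bd_one n (inr a)]bd_oneE.
by case: ifP => [_ [b ->]|_ ->]; rewrite bd_oneE //; exists b.
Qed.

Lemma card_unmated_le D :
  (#|[pred a | top_mate D a == a]|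
     <= #|[pred a | top_mate (bd_flip D) a == a]|)%N.
Proof.
pose g a := if D (inl a) is inr b then b else a.
have gP a : top_mate D a == a -> D (inl a) = inr (g a).
  by move=> e; have := top_mateP D a; rewrite /g e => -[b ->].
rewrite -(@card_in_image _ _ g [pred a | top_mate D a == a]).
  apply/subset_leq_card/subsetP => b /imageP[a /gP e ->].
  have := bot_mateP D (g a); rewrite inE /=; case: eqP => // _.
  by rewrite -e bd_invol.
move=> a b /gP ea /gP eb gab; apply: inl_inj.
by apply: (inv_inj (bd_invol D)); rewrite ea eb gab.
Qed.

(** The through edges pair the fixed points of the two row involutions, so that
both rows have the same number of horizontal edges. *)
Lemma card_unmated D :
  #|[pred a | top_mate D a == a]| = #|[pred a | top_mate (bd_flip D) a == a]|.
Proof.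
apply/eqP; rewrite eqn_leq card_unmated_le.
by have := card_unmated_le (bd_flip D); rewrite bd_flipK.
Qed.

Lemma adj_ex f (k : 'I_n) : (f.*2 <= n)%N -> (k < f.*2)%N ->
  exists2 j, j \in e_seq n f & adj j k.
Proof.
move=> fn kf.
have lt : (k./2.*2.+1 < f.*2)%N by rewrite -doubleS leq_double ltn_half_double.
have lt1 : (k./2.*2 < n.-1)%N by rewrite ltn_predRL (leq_trans lt).
exists (Ordinal lt1); first by rewrite mem_e_seq /= odd_double ltnW.
rewrite /adj -!val_eqE /= -{1 3}(odd_double_half k).
by case: (odd k); rewrite ?eqxx ?orbT.
Qed.

Lemma adj_lt f j (k : 'I_n) : j \in e_seq n f -> adj j k -> (k < f.*2)%N.
Proof.
rewrite mem_e_seq => /andP[ej jf] /orP[]/eqP->//=.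
rewrite ltn_neqAle jf andbT; apply: contraNneq ej => e.
by have := odd_double f; rewrite -e /= => /negbFE.
Qed.

Lemma e_odd_untouched f x : (f.*2 <= strand x)%N -> bd_e_odd n f x = bd_one n x.
Proof.
move=> fx; rewrite bd_e_oddE; apply: e_fold_one (e_seq_even n f) _ _.
apply/hasPn => j jf; apply: contraL fx => /(adj_lt jf).
by rewrite -ltnNge.
Qed.

Lemma e_oddl f j : j \in e_seq n f ->
  bd_e_odd n f (inl (adjl j)) = inl (adjr j) /\
  bd_e_odd n f (inr (adjl j)) = inr (adjr j).
Proof.
move=> jf; rewrite bd_e_oddE; have ok := e_seq_even n f.
by split; rewrite (e_fold_touched (j := j)) // ?bd_e_cap ?bd_capE ?adj_neq ?eqxx
  // /adj eqxx.
Qed.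

(** d1 and d2 bring the horizontal edges of both rows to the standard places,
and the through edges then define the middle permutation. *)
Lemma bd_factors_ex D : exists t, bd_factors D t.
Proof.
have [f [d1 d1P [c1 ev1 od1]]] := dset_ex (top_mateK D).
have [f2 [d2 d2P [c2 ev2 od2]]] := dset_ex (top_mateK (bd_flip D)).
have ef : f2 = f.
  by apply: double_inj; apply/eqP;
    rewrite -(eqn_add2r #|[pred a | top_mate D a == a]|) c1 card_unmated c2.
rewrite {}ef in d2P c2 ev2 od2.
have fn : (f.*2 <= n)%N by rewrite -c1 leq_addr.
have e1 j : j \in e_seq n f -> D (inl (d1 (adjl j))) = inl (d1 (adjr j)).
  move=> jf; have := jf; rewrite mem_e_seq => /andP[ej ltj].
  have := top_mateP D (d1 (adjl j)); rewrite (ev1 _ (adjr j)) //=.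
  by rewrite (inj_eq perm_inj) eq_sym (negbTE (adj_neq j)).
have e2 j : j \in e_seq n f -> D (inr (d2 (adjl j))) = inr (d2 (adjr j)).
  move=> jf; have := jf; rewrite mem_e_seq => /andP[ej ltj].
  have := bot_mateP D (d2 (adjl j)); rewrite (ev2 _ (adjr j)) //=.
  by rewrite (inj_eq perm_inj) eq_sym (negbTE (adj_neq j)).
have lo2 (k : 'I_n) : (k < f.*2)%N -> exists b, D (inr (d2 k)) = inr b.
  move=> kf; have [j jf /orP[]/eqP->] := adj_ex fn kf.
    by rewrite e2 //; exists (d2 (adjr j)).
  by rewrite -e2 // bd_invol; exists (d2 (adjl j)).
pose g a := if D (inl a) is inr b then b else a.
have gP (k : 'I_n) : (f.*2 <= k)%N -> D (inl (d1 k)) = inr (g (d1 k)).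
  move=> /od1 e; have := top_mateP D (d1 k); rewrite e eqxx /g.
  by case=> b ->.
pose sf (k : 'I_n) := if (k < f.*2)%N then k else (d2^-1)%g (g (d1 k)).
have sf_hi (k : 'I_n) : (f.*2 <= k)%N -> (f.*2 <= sf k)%N.
  move=> fk; rewrite /sf ltnNge fk /= leqNgt; apply/negP => /lo2[b].
  by rewrite permKV -gP // bd_invol.
have sf_inj : injective sf.
  move=> i j; case: (ltnP i f.*2) (ltnP j f.*2) => [li|gi] [lj|gj].
  - by rewrite /sf li lj.
  - by move=> e; have := sf_hi j gj; rewrite -e /sf li leqNgt li.
  - by move=> e; have := sf_hi i gi; rewrite e /sf lj leqNgt lj.
  rewrite /sf !ltnNge gi gj /= => /perm_inj e; apply: (@perm_inj _ d1);
    apply: inl_inj.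
  by apply: (inv_inj (bd_invol D)); rewrite !gP // e.
pose s := perm sf_inj.
have sE k : s k = sf k by rewrite permE.
have fN : (f < n./2.+1)%N by rewrite ltnS -(doubleK f) half_leq.
exists (Ordinal fN, d1, d2, s); apply/and4P; split=> //.
  apply/subsetP => k; rewrite !inE sE; apply: contraR.
  by rewrite -ltnNge /sf => ->.
apply/eqP; rewrite (bd_comp_perml d1^-1 (bd_e_odd n f)).2 (bd_comp_permr _ _).2
  (bd_comp_permr _ _).2.
rewrite -!bd_conjM invgK; apply/esym/bd_conj_eq => -[] k;
  rewrite !permM !rowpE ?sE.
  have [lk|gk] := ltnP k f.*2.
    have [j jf /orP[]/eqP->] := adj_ex fn lk; have [El Er] := e_oddl jf.
      by rewrite El !rowpE e1.
    by rewrite -El bd_invol !rowpE -e1 // bd_invol.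
  rewrite e_odd_untouched // bd_oneE !rowpE sE gP // /sf ltnNge gk /=.
  by rewrite permKV.
rewrite /sf; case: ltnP => [lk|gk].
  have [j jf jk] := adj_ex fn lk; have [El Er] := e_oddl jf.
  have jrl : (adjr j < f.*2)%N by apply: (adj_lt jf); rewrite /adj eqxx orbT.
  have jll : (adjl j < f.*2)%N by apply: (adj_lt jf); rewrite /adj eqxx.
  case/orP: jk => /eqP->.
    by rewrite Er !rowpE sE /sf jrl e2.
  by rewrite -Er bd_invol !rowpE sE /sf jll -e2 // bd_invol.
by rewrite e_odd_untouched // bd_oneE !rowpE permKV -gP // bd_invol.
Qed.

Lemma bd_sign_conj q : bd_sign (bd_conj q (bd_one n)) = chi q.
Proof.
rewrite /bd_sign; case: pickP => [[[[f d1] d2] s] H|/= none].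
  exact: bd_factors_sign H _.
by have [t] := bd_factors_ex (bd_conj q (bd_one n)); rewrite none.
Qed.

End Factorization.

(** * Antisymmetrized diagrams *)

Section Antisymmetrization.
Variables (K : fieldType) (m n : nat).
Implicit Types (D : bdiag n) (B : {set bvertex n}) (p q : {perm bvertex n}).

(** When [B] contains no edge of [D], this is a minor of the generic symmetric
matrix indexed by the vertices, with columns [B] and rows the mates of [B],
times the monomial of the other edges of [D]. *)
Definition bd_antisym D B : brauer K m n :=
  \sum_(p | perm_on B p) (-1) ^+ odd_perm p *: bd_basis K m (bd_conj p D).

Lemma perm_onJ B p q : perm_on (q @: B) (p ^ q)%g = perm_on B p.
Proof.
apply/subsetP/subsetP => on x; last rewrite -[x](permKV q); rewrite inE => px.
  have : q x \in q @: B by apply: on; rewrite inE permJ (inj_eq perm_inj).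
  by rewrite mem_imset //; apply: perm_inj.
rewrite mem_imset; last exact: perm_inj.
by apply: on; rewrite inE; move: px; rewrite permJ (inj_eq perm_inj).
Qed.

Lemma bd_antisym_conj q D B : bd_antisym (bd_conj q D) (q @: B) =
  \sum_(p | perm_on B p)
     (-1) ^+ odd_perm p *: bd_basis K m (bd_conj q (bd_conj p D)).
Proof.
rewrite /bd_antisym (reindex_inj (conjg_inj q)); apply: eq_big => p;
  first by rewrite perm_onJ.
by move=> _; rewrite odd_permJ -!bd_conjM -conjgC.
Qed.

Lemma bd_antisym_on q D B : perm_on B q ->
  bd_antisym (bd_conj q D) B = (-1) ^+ odd_perm q *: bd_antisym D B.
Proof.
move=> qB; rewrite scaler_sumr [RHS](reindex_inj (mulgI q)); apply: eq_big => p.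
  apply/idP/idP => [|h]; first exact: perm_onM.
  by rewrite -[p](mulKg q) perm_onM // perm_onV.
by move=> _; rewrite odd_permM signr_addb scalerA mulrA -signr_addb addbb mul1r
  -bd_conjM.
Qed.

(** Permuting one end of the edges by p or the other end by the inverse of p
gives the same matching: a determinant does not change under transposition. *)
Lemma bd_antisym_mate D B :
  [disjoint D @: B & B] -> bd_antisym D (D @: B) = bd_antisym D B.
Proof.
move=> dis; have dE : D @: B = bd_as_perm D @: B by apply: eq_imset => x;
  rewrite bd_as_permE.
have eD : bd_conj (bd_as_perm D) D = D.
  by apply: bd_conj_eq => x; rewrite !bd_as_permE.
rewrite dE -{1}eD bd_antisym_conj /bd_antisym [RHS](reindex_inj invg_inj).
apply: eq_big => [p|p pB].
  by apply/idP/idP => /perm_onV; rewrite ?invgK.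
rewrite odd_permV; congr (_ *: bd_basis _ _ _).
(* p and its conjugate by D have disjoint supports, hence commute. *)
suff key : bd_conj (p * bd_as_perm D * p) D = D.
  by rewrite -bd_conjM -{3}key -bd_conjM mulgK.
apply: bd_conj_eq => x; rewrite !permM !bd_as_permE.
have notB y : y \in B -> D y \notin B.
  by move=> yB; rewrite (disjointFr dis) // imset_f.
have fixp y : y \notin B -> p y = y by apply: out_perm.
have pinB y : (p y \in B) = (y \in B) by apply: perm_closed.
have [xB|xB] := boolP (x \in B).
  rewrite [p (D (p x))]fixp ?notB ?pinB // bd_invol.
  by rewrite [p (D x)]fixp ?notB // bd_invol.
rewrite (fixp x) //; have [DxB|DxB] := boolP (D x \in B).
  by rewrite [RHS]fixp // notB // pinB.
by rewrite (fixp (D x)) // bd_invol fixp.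
Qed.

Section Antisym_one.
Variables a b : nat.

(** Rows and columns of the minor that [brauer_E2] stands for. *)
Definition src_pred (x : bvertex n) : bool :=
  match x with inl i => i < a | inr i => a <= i < a + b end%N.
Definition tgt_pred (x : bvertex n) : bool :=
  match x with inl i => a <= i < a + b | inr i => i < a end%N.

Let tgt := [set x | tgt_pred x].

Lemma src_pred_one x : src_pred (bd_one n x) = tgt_pred x.
Proof. by rewrite bd_oneE; case: x. Qed.

Lemma tgt_pred_one x : tgt_pred (bd_one n x) = src_pred x.
Proof. by rewrite bd_oneE; case: x. Qed.

Lemma src_not_tgt x : src_pred x -> tgt_pred x = false.
Proof.
case: x => i /= => [ia|/andP[ai _]]; first by rewrite leqNgt ia.
by rewrite ltnNge ai.
Qed.

Lemma Bd_setP D : reflect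
   ((forall x, ~~ src_pred x -> ~~ tgt_pred x -> D x = bd_one n x) /\
    (forall x, src_pred x -> tgt_pred (D x))) (D \in Bd_set n a b).
Proof.
rewrite inE; apply: (iffP andP) => [[/forallP H1 /forallP H2]|[H1 H2]].
  split=> x.
    have P (i : 'I_n) : ~~ (i < a)%N -> ~~ (a <= i < a + b)%N -> D (inl i) =
      inr i.
      rewrite -leqNgt => ai; rewrite ai /= -leqNgt => abi.
      by have /implyP/(_ abi)/eqP := H1 i.
    case: x => i /= N1 N2; rewrite bd_oneE; first exact: P.
    by rewrite -P // bd_invol.
  by move=> sx; have /implyP := H2 x; apply.
split; apply/forallP => x; last by apply/implyP; apply: H2.
apply/implyP => abx; rewrite H1 ?bd_oneE //=.
  by rewrite -leqNgt (leq_trans _ abx) ?leq_addr.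
by rewrite [(x < _)%N]ltnNge abx andbF.
Qed.

(** The condition that defines [Bd_set] makes its diagrams the bijections from
[src_pred] to [tgt_pred], and the identity diagram is one of them. *)
Lemma Bd_set_imset :
  Bd_set n a b = [set bd_conj p (bd_one n) | p in [pred p | perm_on tgt p]].
Proof.
apply/setP => D; apply/Bd_setP/imsetP => [[D1 D2]|[p pB ->]].
  pose f x := if tgt_pred x then D (bd_one n x) else x.
  have ft x : tgt_pred (f x) = tgt_pred x.
    by rewrite /f; case: ifP => // tx; rewrite D2 // src_pred_one.
  have f_inj : injective f.
    move=> x y e; have := ft x; rewrite e ft /f => t; move: e; rewrite /f t.
    by case: ifP => // _ /(inv_inj (bd_invol D))/(inv_inj (bd_invol _)).
  exists (perm f_inj).
    by apply/subsetP => x; rewrite !inE permE /f; apply: contraR => /negbTE->.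
  apply/esym/bd_conj_eq => x; rewrite !permE /f tgt_pred_one.
  case: ifPn => tx; case: ifPn => sx.
  - by rewrite src_not_tgt in tx.
  - by rewrite bd_invol.
  - by rewrite bd_invol.
  exact: D1.
have fixp x : ~~ tgt_pred x -> p x = x by move=> H; apply: (out_perm pB);
  rewrite inE.
have tp x : tgt_pred (p x) = tgt_pred x.
  by have := perm_closed x pB; rewrite !inE.
split=> x.
  by move=> sx tx; rewrite -{1}(fixp x) // bd_conj_apply fixp // tgt_pred_one.
move=> sx; have nx : ~~ tgt_pred x by rewrite src_not_tgt.
by rewrite -(fixp x nx) bd_conj_apply tp tgt_pred_one.
Qed.

(** The orientation of an edge from [src_pred] to [tgt_pred] depends only on the
row of its end in [tgt_pred], as recorded by eps. A permutation of these ends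
does not change the product of the eps. *)
Lemma chi_tgt p : perm_on tgt p -> chi p = (-1) ^+ odd_perm p.
Proof.
move=> pB.
have fixp x : ~~ tgt_pred x -> p x = x by move=> H; apply: (out_perm pB);
  rewrite inE.
have tp x : tgt_pred (p x) = tgt_pred x.
  by have := perm_closed x pB; rewrite !inE.
pose eps (x : bvertex n) : int :=
  if tgt_pred x then (if x is inl _ then -1 else 1) else 1.
have epsK x : eps x * eps x = 1 by rewrite /eps; case: ifP => //; case: x.
rewrite /chi; suff -> : \prod_i edge_sign (p (inl i)) (p (inr i)) =
  1 by rewrite mulr1.
transitivity (\prod_x (eps (p x) * eps x)).
  rewrite big_sumType /= -big_split /=; apply: eq_bigr => i _.
  rewrite /eps /= !tp; have [lti|lei] := ltnP i a.
    rewrite [tgt_pred (inl i)]/= [tgt_pred (inr i)]/= (ltn_geF lti) lti /=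
      !mul1r mulr1.
    rewrite (fixp (inl i)) /=; last by rewrite leqNgt lti.
    have := tp (inr i); rewrite /= lti.
    case e : (p (inr i)) => [j|j] //= /andP[aj _].
    by rewrite /edge_sign /= (leq_trans lti aj).
  rewrite [tgt_pred (inr i)]/= (leq_gtF lei) [tgt_pred (inl i)]/= lei /= !mulr1.
  rewrite (fixp (inr i)) /=; last by rewrite -leqNgt.
  case: ifP => [iab|niab]; last first.
    by rewrite (fixp (inl i)) //= lei niab.
  have := tp (inl i); rewrite /= lei iab.
  case e : (p (inl i)) => [j|j] //= ja.
  by rewrite /edge_sign /= (leq_trans ja lei).
have -> : \prod_x (eps (p x) * eps x) = \prod_x (eps x * eps x).
  rewrite !big_split /=; congr (_ * _).
  by rewrite [RHS](reindex_inj (@perm_inj _ p)).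
by rewrite big1.
Qed.

(** The sign of a diagram in [Bd_set] is the signature of the bijection that it
is, so that E_{a,b} is a determinant. *)
Lemma brauer_E2_antisym : brauer_E2 K m n a b = bd_antisym (bd_one n) tgt.
Proof.
rewrite /brauer_E2 Bd_set_imset big_imset /=; last first.
  move=> p q pB qB e; apply/permP => x.
  have fixp r y : perm_on tgt r -> ~~ tgt_pred y -> r y = y.
    by move=> H Hy; apply: (out_perm H); rewrite inE.
  have [tx|tx] := boolP (tgt_pred x); last by rewrite !fixp.
  have sx : ~~ tgt_pred (bd_one n x) by rewrite src_not_tgt // src_pred_one.
  have := bd_conj_apply p (bd_one n) (bd_one n x).
  rewrite e bd_invol => <-.
  by rewrite [p _]fixp // -{1}(fixp q (bd_one n x)) // bd_conj_apply bd_invol.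
apply: eq_bigr => p pB; rewrite bd_sign_conj chi_tgt //.
by rewrite rmorph_sign.
Qed.

End Antisym_one.

End Antisymmetrization.

(** * Lexicographic order, chains and separating colourings *)

Section Lex.
Variable n : nat.
Implicit Types (D : bdiag n) (B : {set bvertex n}).
Implicit Types (p q : {perm bvertex n}) (x y z : bvertex n).

(** Any linear order of the vertices would do. *)
Definition rk x : nat := enum_rank x.

Lemma rk_inj : injective rk.
Proof. by move=> x y /val_inj/enum_rank_inj. Qed.

Lemma rk_eq x y : (rk x == rk y) = (x == y).
Proof. exact: inj_eq rk_inj _ _. Qed.

Lemma rk_total x y : x != y -> (rk x < rk y)%N || (rk y < rk x)%N.
Proof. by rewrite -rk_eq neq_ltn. Qed.

Definition lexlt D D' := [exists x, (rk (D x) < rk (D' x))%N &&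
  [forall y, (rk y < rk x)%N ==> (D y == D' y)]].

Lemma lexltP D D' : reflect (exists2 x, (rk (D x) < rk (D' x))%N &
   forall y, (rk y < rk x)%N -> D y = D' y) (lexlt D D').
Proof.
apply: (iffP existsP) => [[x /andP[lt /forallP H]]|[x lt H]]; exists x => //.
  by move=> y yx; apply/eqP; have /implyP := H y; apply.
by rewrite lt; apply/forallP => y; apply/implyP => /H->.
Qed.

Lemma lexlt_irr D : lexlt D D = false.
Proof. by apply/lexltP => -[x]; rewrite ltnn. Qed.

Lemma lexlt_trans : transitive lexlt.
Proof.
move=> D2 D1 D3 /lexltP[x lx Hx] /lexltP[y ly Hy]; apply/lexltP.
have [xy|yx|/rk_inj exy] := ltngtP (rk x) (rk y).
- exists x; first by rewrite -Hy.
  by move=> z zx; rewrite Hx // Hy // (ltn_trans zx).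
- exists y; first by rewrite Hx.
  by move=> z zy; rewrite Hx ?Hy // (ltn_trans zy).
rewrite {}exy in lx Hx; exists y; first exact: ltn_trans lx ly.
by move=> z zy; rewrite Hx ?Hy.
Qed.

(** Inductions along the lexicographic order use the number of larger, or of
smaller, diagrams. *)
Lemma lexlt_above D D' : lexlt D D' ->
  (#|[set E | lexlt D' E]| < #|[set E | lexlt D E]|)%N.
Proof.
move=> lt; apply/proper_card/properP; split.
  by apply/subsetP => E; rewrite !inE; apply: lexlt_trans.
by exists D'; rewrite !inE ?lexlt_irr.
Qed.

Lemma lexlt_below D D' : lexlt D D' ->
  (#|[set E | lexlt E D]| < #|[set E | lexlt E D']|)%N.
Proof.
move=> lt; apply/proper_card/properP; split.
  by apply/subsetP => E; rewrite !inE => /lexlt_trans; apply.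
by exists D; rewrite !inE ?lexlt_irr.
Qed.

Lemma first_diff D D' : D != D' -> exists2 x, D x != D' x &
  forall y, (rk y < rk x)%N -> D y = D' y.
Proof.
move=> DD'; have [x0 nx0] : exists x, D x != D' x.
  by apply/existsP; apply: contraNT DD' => /existsPn H; apply/eqP/bdiagP => x;
    apply/eqP; rewrite -[_ == _]negbK H.
exists [arg min_(x < x0 | D x != D' x) rk x]; case: arg_minnP => // x nx min.
by move=> y yx; apply: contraTeq yx => /min; rewrite -leqNgt.
Qed.

(** The edges at [B] form the main diagonal of a minor: their smaller ends,
outside of [B], and their larger ends increase together. *)
Definition chain D B := [forall y in B, (rk (D y) < rk y)%N &&
  [forall z in B, (rk y < rk z)%N ==> (rk (D y) < rk (D z))%N]].

Lemma chainP D B : reflect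
  ((forall y, y \in B -> (rk (D y) < rk y)%N) /\
   (forall y z, y \in B -> z \in B -> (rk y < rk z)%N ->
      (rk (D y) < rk (D z))%N))
  (chain D B).
Proof.
apply: (iffP forall_inP) => [H|[H1 H2] y yB].
  split=> [y /H/andP[]//|y z /H/andP[_ /forall_inP/(_ z)]].
  by move=> + zB => /(_ zB)/implyP.
by rewrite H1 //; apply/forall_inP => z zB; apply/implyP; apply: H2.
Qed.

Lemma chain_sub D B B' : B' \subset B -> chain D B -> chain D B'.
Proof.
move=> /subsetP sB /chainP[H1 H2]; apply/chainP.
by split=> [y /sB/H1|y z /sB yB /sB zB]; last exact: H2.
Qed.

Lemma chain_disjoint D B : chain D B -> [disjoint D @: B & B].
Proof.
move=> /chainP[H1 H2]; rewrite disjoint_subset;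
  apply/subsetP => _ /imsetP[y yB ->].
rewrite inE; apply/negP => DyB; have lt := H1 y yB.
by have := H2 _ _ DyB yB lt; rewrite bd_invol ltnNge (ltnW lt).
Qed.

(** The main diagonal is the leading term of the minor. If y is the smallest
vertex moved by p, then the two matchings agree below the smaller end of the
edge at y, and there y is replaced by the larger p y. *)
Lemma chain_conj_gt D B p : chain D B -> perm_on B p -> p != 1%g ->
  lexlt D (bd_conj p D).
Proof.
move=> /chainP[H1 H2] pB p1.
have [y0 y0p] : exists y, p y != y.
  by apply/existsP; apply: contraNT p1 => /existsPn H; apply/eqP/permP => x;
    rewrite perm1; apply/eqP; rewrite -[_ == _]negbK H.
pose y := [arg min_(y < y0 | p y != y) rk y].
have [py ymin] : p y != y /\ forall z, (rk z < rk y)%N -> p z = z.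
  rewrite /y; case: arg_minnP => // x nx min; split=> // z zx.
  by apply: contraTeq zx => /min; rewrite -leqNgt.
have yB : y \in B by have /subsetP := pB; apply.
have Dyy := H1 y yB.
have pVfix z : p z = z -> (p^-1)%g z = z by move=> e; rewrite -{1}e permK.
apply/lexltP; exists (D y).
  rewrite bd_invol bd_conjE pVfix ?bd_invol; last exact: ymin.
  have [lt|//] := orP (rk_total py).
  by have /perm_inj/eqP := ymin _ lt; rewrite (negbTE py).
move=> x xDy; rewrite bd_conjE pVfix; last by rewrite ymin // (ltn_trans xDy).
have [DxB|DxB] := boolP (D x \in B); last by rewrite (out_perm pB).
rewrite ymin //.
have [e|ne] := eqVneq (D x) y; first by rewrite -e bd_invol ltnn in xDy.
have [//|lt] := orP (rk_total ne).
by have := H2 _ _ yB DxB lt; rewrite bd_invol ltnNge (ltnW xDy).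
Qed.

Definition closer D x := if (rk x < rk (D x))%N then D x else x.

Definition level D y : nat :=
  \max_(B : {set bvertex n} |
      [&& chain D B, y \in B & [forall z in B, (rk z <= rk y)%N]]) #|B|.

Lemma closerP D x : (rk (D (closer D x)) < rk (closer D x))%N.
Proof.
rewrite /closer; have := rk_total (bd_neq D x); case: ifP => [|_];
  first by rewrite bd_invol.
by rewrite orbF.
Qed.

Lemma closer_mate D x : closer D (D x) = closer D x.
Proof.
rewrite /closer bd_invol; have := rk_total (bd_neq D x).
by case: ltngtP.
Qed.

Lemma level_gt0 D y : (rk (D y) < rk y)%N -> (0 < level D y)%N.
Proof.
move=> Dy; rewrite -(cards1 y); apply: leq_bigmax_cond [set y] _.
rewrite set11; apply/and3P; split=> //.
  apply/chainP; split=> [z /set1P->//|z t /set1P-> /set1P->].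
  by rewrite ltnn.
by apply/forall_inP => z /set1P->.
Qed.

Lemma level_lt D y z : (rk (D y) < rk y)%N -> (rk (D z) < rk z)%N ->
  (rk y < rk z)%N -> (rk (D y) < rk (D z))%N -> (level D y < level D z)%N.
Proof.
move=> Dy Dz yz Dyz.
pose P y (B : {set bvertex n}) :=
  [&& chain D B, y \in B & [forall z in B, (rk z <= rk y)%N]].
have [B /and3P[/chainP[H1 H2] yB /forall_inP By] eB] : exists2 B,
  P y B & level D y = #|B|.
  have [B0 PB0] : exists B, P y B.
    apply/existsP; have := level_gt0 Dy; apply: contraTT => /existsPn H.
    by rewrite -leqNgt leqn0 /level big_pred0 // => B; apply/negbTE/H.
  by rewrite /level (bigmax_eq_arg B0) //; case: arg_maxnP => // B PB _;
    exists B.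
have zB : z \notin B by apply/negP => /By; rewrite leqNgt yz.
have Bz t : t \in B -> (rk t < rk z)%N by move/By => ty;
  apply: leq_ltn_trans yz.
rewrite eB -add1n; have -> : (1 + #|B|)%N = #|z |: B| by rewrite cardsU1 zB.
apply: leq_bigmax_cond (z |: B) _.
rewrite setU11; apply/and3P; split=> //; last first.
  by apply/forall_inP => t /setU1P[->//|/Bz/ltnW].
apply/chainP; split=> [t /setU1P[->|/H1]//|s t /setU1P[->|sB] /setU1P[->|tB]
  st].
- by rewrite ltnn in st.
- by have := Bz t tB; rewrite ltnNge (ltnW st).
- have [->//|sy] := eqVneq s y; apply: ltn_trans Dyz; apply: H2 => //.
  by rewrite ltn_neqAle rk_eq sy By.
exact: H2.
Qed.

Definition chain_free m D :=
  [forall B : {set bvertex n}, chain D B ==> (#|B| <= m)%N].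

Lemma level_le m D y : chain_free m D -> (level D y <= m)%N.
Proof.
by move=> /forallP H; apply/bigmax_leqP => B /and3P[cB _ _];
  have /implyP := H B; apply.
Qed.

(** Colour the edges by their level. Two edges of the same level do not increase
together, so that in each colour [D] is totally nested: the smallest vertex is
matched with the largest one, and so on. This is the lexicographically largest
matching with these colour classes. *)
Lemma separating_colouring m D : chain_free m D -> exists c : bvertex n -> 'I_m,
  (forall x, c (D x) = c x) /\
  forall D', (forall x, c (D' x) = c x) -> D' = D \/ lexlt D' D.
Proof.
move=> cf.
have ltm x : ((level D (closer D x)).-1 < m)%N.
  by rewrite prednK ?level_le // level_gt0 ?closerP.
exists (fun x => Ordinal (ltm x)); split=> [x|D' D'c]; first by apply: val_inj;
  rewrite /= closer_mate.
have {}D'c x : level D (closer D (D' x)) = level D (closer D x).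
  by have := congr1 S (congr1 val (D'c x));
    rewrite /= !prednK // level_gt0 ?closerP.
have [->|DD'] := eqVneq D' D; [by left|right].
have [x nx Hx] := first_diff DD'; apply/lexltP; exists x => //.
have [//|lt] := orP (rk_total nx); exfalso.
(* Otherwise the edge of D at w := D' x has the same colour as the edge x u,
   but its larger end lies above u and its smaller end above x. *)
have xDx : (rk x < rk (D x))%N.
  have [//|Dxx] := orP (rk_total (bd_neq D x : D x != x)).
    by move=> l; have := Hx _ l; rewrite bd_invol => /(canRL (bd_invol D')) e;
      rewrite e eqxx in nx.
  by [].
set w := D' x in lt nx; set u := D x in lt nx xDx.
have cu : closer D x = u by rewrite /closer -/u xDx.
have xDw : (rk x < rk (D w))%N.
  have ne : x != D w by apply: contraNneq nx => e;
    apply/eqP/(inv_inj (bd_invol D)); rewrite /u bd_invol.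
  have [//|Dwx] := orP (rk_total ne).
  by have := Hx _ Dwx; rewrite bd_invol => /(canLR (bd_invol D'));
    rewrite /w bd_invol => e; rewrite -e ltnn in Dwx.
have lw := D'c x; rewrite -/w cu in lw.
have uw : (rk u < rk (closer D w))%N.
  by rewrite /closer; case: ifP => // /(ltn_trans lt).
have Duw : (rk (D u) < rk (D (closer D w)))%N.
  rewrite /u bd_invol /closer; case: ifP => _; rewrite ?bd_invol //.
  exact: ltn_trans xDx lt.
have := level_lt _ (closerP D w) uw Duw; rewrite lw ltnn => H; apply: notF;
  apply: H.
by rewrite /u bd_invol.
Qed.

End Lex.

(** * Multilinear extension and evaluation of linear combinations *)

Section MultilinearExt.
Variables (K : fieldType) (X : finType) (V : vectType K) (W : lmodType K).

Definition upd (f : {ffun X -> V}) x (w : V) : {ffun X -> V} :=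
  [ffun k => if k == x then w else f k].

(** One argument after the other is expanded on the basis; S collects the
arguments that are not yet basis vectors. *)
Lemma multilinear_ext m (v : m.-tuple V) (t : {ffun X -> V} -> W) :
  basis_of fullv v -> (forall f x, linear (fun w => t (upd f x w))) ->
  (forall c : X -> 'I_m, t [ffun x => tnth v (c x)] = 0) -> forall f, t f = 0.
Proof.
move=> vb lin t0 f.
suff main (S : {set X}) : forall f : {ffun X -> V},
    (forall x, x \notin S -> exists i, f x = tnth v i) -> t f = 0.
  by apply: (main setT) => x; rewrite inE.
move: {2}#|S| (erefl #|S|) => s; elim: s S => [|s IHs] S cS {}f fS.
  have [c cP] : exists c : X -> 'I_m, forall x, f x = tnth v (c x).
    by apply: (@fin_all_exists X (fun=> 'I_m) (fun x i => f x = tnth v i)) => x;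
      apply: fS; rewrite (cards0_eq cS) inE.
  by rewrite -(t0 c); congr t; apply/ffunP => x; rewrite ffunE cP.
have [x xS] : exists x, x \in S by apply/set0Pn; rewrite -card_gt0 cS.
have -> : f = upd f x (\sum_(i < m) coord v i (f x) *: v`_i).
  apply/ffunP => k; rewrite ffunE; case: eqP => // ->.
  by rewrite -(coord_basis vb) // memvf.
pose l : {linear V -> W} := HB.pack (fun w => t (upd f x w))
  (GRing.isLinear.Build _ _ _ _ (fun w => t (upd f x w)) (lin f x)).
rewrite -[LHS]/(l _) linear_sum big1 // => i _;
  rewrite linearZ /= (IHs (S :\ x)) ?scaler0 //.
  by apply/eqP; rewrite -eqSS -cS (cardsD1 x S) xS.
move=> y; rewrite !inE ffunE; case: eqP => [_ _|_ /fS //].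
by exists i; rewrite (tnth_nth 0).
Qed.

End MultilinearExt.

Section Pairing.
Variables (K : fieldType) (m n : nat).
Implicit Types (D : bdiag n) (B : {set bvertex n}).

Definition pairing (phi : bdiag n -> K) (x : brauer K m n) : K^o :=
  \sum_D x D * phi D.

Lemma pairing_linear phi : linear (pairing phi).
Proof.
move=> a x y; rewrite /pairing scaler_sumr -big_split.
by apply: eq_bigr => D _; rewrite !ffunE /GRing.scale /= mulrDl mulrA.
Qed.

HB.instance Definition _ phi := GRing.isLinear.Build K (brauer K m n) K^o _
  (pairing phi) (pairing_linear phi).

Lemma pairing_basis D phi : pairing phi (bd_basis K m D) = phi D.
Proof.
rewrite /pairing (bigD1 D) //= big1 ?addr0 => [|E ED];
  rewrite ffunE ?eqxx ?mul1r //.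
by rewrite (negbTE ED) mul0r.
Qed.

Lemma pairing_antisym D B phi : pairing phi (bd_antisym K m D B) =
  \sum_(p | perm_on B p) (-1) ^+ odd_perm p * phi (bd_conj p D).
Proof.
rewrite linear_sum; apply: eq_bigr => p _.
by rewrite linearZ /= pairing_basis.
Qed.

(** The condition for the basis vectors coloured by c to have a nonzero value on
[D]: v_i pairs to 1 with v_(rev_ord i) and to 0 with the others. *)
Definition fits (D : bdiag n) (c : bvertex n -> 'I_m) : bool :=
  [forall x, c (D x) == rev_ord (c x)].

Lemma fitsP D (c : bvertex n -> 'I_m) :
  reflect (forall x, c (D x) = rev_ord (c x)) (fits D c).
Proof. by apply: (iffP forallP) => H x; apply/eqP. Qed.

Lemma fits_conj (p : {perm bvertex n}) D (c c' : bvertex n -> 'I_m) :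
  (forall x, c' x = c (p x)) -> fits (bd_conj p D) c = fits D c'.
Proof.
move=> e; apply/fitsP/fitsP => H x; first by rewrite !e -bd_conj_apply.
by rewrite -[x](permKV p) bd_conj_apply -!e.
Qed.

(** Two of the more than m vertices in [B] get the same colour; exchanging them
matches each term of the sum with a term of opposite sign. *)
Lemma fits_antisym (charK : 2%N \notin [pchar K]) D B
    (c : bvertex n -> 'I_m) :
  (m < #|B|)%N -> pairing (fun D => (fits D c)%:R) (bd_antisym K m D B) = 0.
Proof.
move=> mB; rewrite pairing_antisym.
have [a [b [aB bB ab cab]]] : exists a, exists b,
  [/\ a \in B, b \in B, a != b & c a = c b].
  have /imset_injP ninj : ~~ (#|c @: B| == #|B|).
    rewrite neq_ltn; apply/orP; left; apply: leq_ltn_trans mB.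
    by rewrite -[X in (_ <= X)%N]card_ord max_card.
  have : ~~ [forall a in B, [forall b in B, (c a == c b) ==> (a == b)]].
    apply/negP => /forall_inP H; apply: ninj => a b aB bB /eqP e.
    by have /forall_inP/(_ b bB)/implyP/(_ e)/eqP := H a aB.
  case/forall_inPn => a aB /forall_inPn[b bB];
    rewrite negb_imply => /andP[/eqP e ab].
  by exists a, b.
set S := \sum_(p | _) _.
have SN : S = - S.
  rewrite {1}/S (reindex_inj (mulIg (tperm a b))) -sumrN; apply: eq_big => p.
    have tB : perm_on B (tperm a b).
      by apply/subsetP => x; rewrite inE; case: tpermP => [->|->|];
        rewrite ?eqxx.
    apply/idP/idP => [h|]; last by move=> h; apply: perm_onM.
    by rewrite -[p](mulgK (tperm a b)) perm_onM // perm_onV.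
  move=> _; rewrite odd_permM odd_tperm ab addbT signrN mulNr;
    congr (- (_ * _%:R)).
  apply: congr1; rewrite (@fits_conj _ _ _ (fun x => c (p x))).
    by symmetry; apply: fits_conj.
  by move=> x; rewrite permM; case: tpermP => [->|->|].
apply/eqP; have /eqP : S + S = 0 by rewrite {1}SN addNr.
rewrite -mulr2n -mulr_natr mulf_eq0 => /orP[//|two0].
by move: charK; rewrite inE /= two0.
Qed.

End Pairing.

(** * The second fundamental theorem *)

Section Contraction.
Variables (K : fieldType) (m n : nat) (V : vectType K) (form : V -> V -> K^o).
Hypothesis form_linear : forall w, linear (form^~ w).
Hypothesis form_sym : forall w w', form w w' = form w' w.
Implicit Types (D : bdiag n) (g : {ffun bvertex n -> V}) (x y : bvertex n).

(** Each edge is read once, from its smaller end. *)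
Definition contract g D : K :=
  \prod_(x | (rk x < rk (D x))%N) form (g x) (g (D x)).

Lemma contract_upd D g x : exists r, forall w,
  contract (upd g x w) D = form w (g (D x)) * r.
Proof.
have [e [ePe exD]] : exists e, (rk e < rk (D e))%N /\ (e = x \/ e = D x).
  have [lt|lt] := orP (rk_total (bd_neq D x)).
    by exists (D x); rewrite bd_invol; split=> //; right.
  by exists x; split=> //; left.
(* e is the end from which the edge at x is read. *)
exists (\prod_(y | (rk y < rk (D y))%N && (y != e)) form (g y) (g (D y))) => w.
rewrite /contract (bigD1 e) //=; congr (_ * _).
  have Dx := negbTE (bd_neq D x).
  by case: exD => ->; rewrite !ffunE ?bd_invol eqxx Dx // form_sym.
apply: eq_bigr => y /andP[yD ye]; rewrite !ffunE.
have yE : y = x \/ y = D x -> y = e.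
  move=> [] yx; case: exD => ex; rewrite ?yx ?ex //; move: yD ePe;
    by rewrite yx ex bd_invol => l1 l2; have := ltn_trans l1 l2; rewrite ltnn.
have yx : y != x by apply: contraNneq ye => yx; apply/eqP/yE; left.
have Dyx : D y != x.
  by apply: contraNneq ye => Dy; apply/eqP/yE; right; rewrite -Dy bd_invol.
by rewrite (negbTE yx) (negbTE Dyx).
Qed.

Lemma contract_linear (z : brauer K m n) g x :
  linear (fun w => pairing (contract (upd g x w)) z : K^o).
Proof.
move=> a w w'; rewrite /pairing scaler_sumr -big_split;
  apply: eq_bigr => D _ /=.
have [r rE] := contract_upd D g x; rewrite !rE form_linear /GRing.scale /=.
by rewrite mulrDl mulrDr -!mulrA [z D * (a * _)]mulrCA.
Qed.

Lemma contract_fits (v : 'I_m -> V) D (c : bvertex n -> 'I_m) :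
  (forall i j, form (v i) (v j) = (i == rev_ord j)%:R) ->
  contract [ffun x => v (c x)] D = (fits D c)%:R.
Proof.
move=> vE; rewrite /contract; under eq_bigr do rewrite !ffunE vE.
have [/fitsP fD|/forallPn[x nx]] := boolP (fits D c).
  by rewrite big1 // => x _; rewrite fD rev_ordK eqxx.
apply/eqP/prodf_eq0.
have [lt|lt] := orP (rk_total (bd_neq D x)).
  by exists (D x); rewrite ?bd_invol ?(negbTE nx).
exists x => //; have -> // : (c x == rev_ord (c (D x))) = false.
by apply: contraNF nx => /eqP->; rewrite rev_ordK.
Qed.

Lemma contract_orthogonal (u : 'I_m -> V) D (c : bvertex n -> 'I_m) :
  (forall i, form (u i) (u i) != 0) ->
  (forall i j, i != j -> form (u i) (u j) = 0) ->
  (contract [ffun x => u (c x)] D != 0) = [forall x, c (D x) == c x].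
Proof.
move=> un uo; rewrite /contract; under eq_bigr do rewrite !ffunE.
apply/prodf_neq0/forallP => [H x|H x _]; last by rewrite (eqP (H x)).
have main y : (rk y < rk (D y))%N -> c (D y) == c y.
  by move=> /H; apply: contraNT => /negbTE cy; rewrite uo // eq_sym cy.
have [lt|lt] := orP (rk_total (bd_neq D x)); last exact: main.
by have := main (D x); rewrite bd_invol eq_sym; apply.
Qed.

End Contraction.

(** [I] stands for any subspace that contains the minors of size m + 1. *)
Section Straightening.
Variables (K : fieldType) (m n : nat).
Variable I : brauer K m n -> Prop.
Hypotheses (I0 : I 0) (ID : forall x y, I x -> I y -> I (x + y)).
Hypothesis IZ : forall a x, I x -> I (a *: x).
Hypothesis I_antisym : forall (D : bdiag n) (B : {set bvertex n}),
  #|B| = m.+1 -> [disjoint D @: B & B] -> I (bd_antisym K m D B).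

Let reducible x := exists2 y : brauer K m n,
  (forall D, ~~ chain_free m D -> y D = 0) & I (x - y).

(** A diagram with a chain of m + 1 edges is, modulo a minor, a combination of
larger diagrams. *)
Lemma straighten x : reducible x.
Proof.
have red0 : reducible 0 by exists 0 => [D _|]; rewrite ?ffunE // subrr.
have redD z t : reducible z -> reducible t -> reducible (z + t).
  move=> [z' z0 Iz] [t' t0 It]; exists (z' + t'); last by rewrite opprD addrACA;
    apply: ID.
  by move=> D nD; rewrite ffunE z0 ?t0 ?addr0.
have redZ a z : reducible z -> reducible (a *: z).
  move=> [z' z0 Iz]; exists (a *: z'); last by rewrite -scalerBr; apply: IZ.
  by move=> D nD; rewrite ffunE z0 ?scaler0.
suff redb D : reducible (bd_basis K m D).
  by rewrite (brauerE x); apply: big_ind => // D _; apply: redZ.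
have [k] := ubnP #|[set E | lexlt D E]|; elim: k D => // k IHk D;
  rewrite ltnS => lek.
have [cf|] := boolP (chain_free m D).
  exists (bd_basis K m D); rewrite ?subrr // => E nE.
  by rewrite ffunE; case: eqP => // e; rewrite e cf in nE.
case/forallPn => B0; rewrite negb_imply -ltnNge => /andP[cB0 mB0].
have [B BB0 cardB] : exists2 B : {set bvertex n}, B \subset B0 & #|B| = m.+1.
  exists [set z in take m.+1 (enum B0)].
    by apply/subsetP => z; rewrite inE => /mem_take; rewrite mem_enum.
  rewrite cardsE (card_uniqP _) ?take_uniq ?enum_uniq // size_takel //.
  by rewrite -cardE.
have cB := chain_sub BB0 cB0.
have : I (bd_antisym K m D B) by apply: I_antisym => //; apply: chain_disjoint.
rewrite /bd_antisym (bigD1 1%g) /=; last by apply: perm_on1.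
rewrite odd_perm1 scale1r bd_conj1; set r := \sum_(p | _) _ => Ir.
have [r' r0 Ir'] : reducible r.
  apply: big_ind => // p /andP[pB p1]; apply/redZ/IHk; apply: leq_trans lek.
  exact/lexlt_above/(chain_conj_gt cB pB p1).
exists (- r'); first by move=> E nE; rewrite ffunE r0 ?oppr0.
have -> : bd_basis K m D - - r' = (bd_basis K m D + r) + (-1) *: (r - r').
  by rewrite scaleN1r opprB opprK addrA [RHS]addrAC addrK.
exact: ID (IZ _ Ir').
Qed.

End Straightening.

(** On each hyperbolic plane take v + v' and v - v', of norms 2 and -2, nonzero
in characteristic other than two; a middle vector has norm 1. *)
Lemma orthogonal_family (K : fieldType) (charK : 2%N \notin [pchar K]) m
    (V : lmodType K) (form : V -> V -> K^o) (v : 'I_m -> V) :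
  (forall w, linear (form^~ w)) -> (forall w w', form w w' = form w' w) ->
  (forall i j, form (v i) (v j) = (i == rev_ord j)%:R) ->
  exists2 u : 'I_m -> V, forall i, form (u i) (u i) != 0 &
    forall i j, i != j -> form (u i) (u j) = 0.
Proof.
move=> forml forms formv.
have two0 : 2%:R != 0 :> K by move: charK; rewrite inE.
pose s (i : 'I_m) : K := if (i < rev_ord i)%N then 1 else if i ==
  rev_ord i then 0 else -1.
pose u i := s i *: v (rev_ord i) + v i.
have formr w a w1 w2 : form w (a *: w1 + w2) = a * form w w1 + form w w2.
  by rewrite forms forml !(forms _ w).
(* s is chosen such that s (rev_ord i) = - s i. *)
have uE i j : form (u i) (u j) =
    (i == rev_ord j)%:R * (1 + s i * s j) + (i == j)%:R * (s i + s j).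
  rewrite /u forml !formr !formv rev_ordK (inj_eq rev_ord_inj).
  rewrite (can2_eq (@rev_ordK _) (@rev_ordK _)).
  rewrite /GRing.scale /= [s i * (_ + _)]mulrDr mulrA !mulrDr mulr1.
  rewrite [(i == j)%:R * s i]mulrC [(i == j)%:R * s j]mulrC
    [(i == rev_ord j)%:R * _]mulrC.
  by rewrite addrACA addrC [s i * _ + _]addrC addrACA [_ + s i * s j * _]addrC.
have sN i : i != rev_ord i -> s (rev_ord i) = - s i /\ s i ^+ 2 = 1.
  move=> ii; rewrite /s rev_ordK eq_sym (negbTE ii); move: ii; rewrite -val_eqE.
  by case: ltngtP => // _ _; rewrite ?opprK ?sqrrN expr1n.
exists u => [i|i j ij]; rewrite uE.
  have [e|ne] := eqVneq i (rev_ord i).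
    have -> : s i = 0 by rewrite /s -e ltnn eqxx.
    by rewrite eqxx !(mul0r, mulr0, mul1r, addr0) oner_eq0.
  have [_ s2] := sN i ne; rewrite mul0r add0r eqxx mul1r -mulr2n -mulr_natr
    mulf_neq0 //.
  by apply/eqP => s0; move/eqP: s2; rewrite s0 expr0n eq_sym oner_eq0.
rewrite (negbTE ij) mul0r addr0; have [e|_] := eqVneq; last by rewrite mul0r.
have ne : j != rev_ord j by rewrite -e eq_sym.
by rewrite e; have [-> s2] := sN j ne; rewrite mulNr -expr2 s2 subrr mulr0.
Qed.

(** After straightening, a combination y of chain-free diagrams is left, and y
evaluates to zero as well. Evaluated on orthogonal vectors coloured after a
chain-free diagram D, only D and smaller diagrams survive: the coefficients of y
vanish one after the other, starting from the smallest diagram. *)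
Theorem second_fundamental (K : fieldType) (charK : 2%N \notin [pchar K])
    (m n : nat) (V : vectType K) (form : V -> V -> K^o) (v : m.-tuple V)
    (I : brauer K m n -> Prop) (x : brauer K m n) :
  (forall w, linear (form^~ w)) -> (forall w w', form w w' = form w' w) ->
  basis_of fullv v ->
  (forall i j : 'I_m, form (tnth v i) (tnth v j) = (i == rev_ord j)%:R) ->
  I 0 -> (forall x y, I x -> I y -> I (x + y)) ->
  (forall a x, I x -> I (a *: x)) ->
  (forall (D : bdiag n) (B : {set bvertex n}), #|B| = m.+1 ->
     [disjoint D @: B & B] -> I (bd_antisym K m D B)) ->
  (forall c : bvertex n -> 'I_m, pairing (fun D => (fits D c)%:R) x = 0) -> I x.
Proof.
move=> forml forms vb formv I0 ID IZ IA x0.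
pose vanishing (z : brauer K m n) := forall c : bvertex n -> 'I_m,
  pairing (fun D => (fits D c)%:R) z = 0.
(* Straightening modulo the combinations of I that vanish as well keeps y
   vanishing. *)
pose I' z := I z /\ vanishing z.
have [y ycf [Ixy xy0]] : exists2 y : brauer K m n,
    (forall D, ~~ chain_free m D -> y D = 0) & I' (x - y).
  apply: straighten => [|z t [Iz z0] [It t0]|a z [Iz z0]|D B cB dis].
  - by split=> // c; rewrite linear0.
  - by split=> [|c]; [apply: ID|rewrite linearD /= z0 t0 addr0].
  - by split=> [|c]; [apply: IZ|rewrite linearZ /= z0 scaler0].
  - by split=> [|c]; [apply: IA|rewrite fits_antisym // cB].
suff y0 : y = 0 by rewrite y0 subr0 in Ixy.
have yv (c : bvertex n -> 'I_m) : pairing (fun D => (fits D c)%:R) y = 0.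
  by have := xy0 c; rewrite linearB /= x0 sub0r => /eqP;
    rewrite oppr_eq0 => /eqP.
have yg (g : {ffun bvertex n -> V}) : pairing (contract form g) y = 0.
  move: g; apply: (multilinear_ext
    (t := fun g => pairing (contract form g) y : K^o) vb).
    by move=> g z; apply: contract_linear.
  move=> c; rewrite -[RHS](yv c); apply: eq_bigr => D _.
  by rewrite (contract_fits _ _ _ (v := tnth v)).
have [u un uo] := orthogonal_family charK forml forms formv.
apply/ffunP => D; rewrite ffunE.
have [k] := ubnP #|[set E | lexlt E D]|; elim: k D => // k IHk D;
  rewrite ltnS => lek.
have [cf|/ycf//] := boolP (chain_free m D).
have [c [cD cmax]] := separating_colouring cf.
have := yg [ffun x => u (c x)]; rewrite /pairing (bigD1 D) //= big1 => [|E ED].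
  move/eqP; rewrite addr0 mulf_eq0 => /orP[/eqP//|].
  suff /negbTE-> : contract form [ffun x => u (c x)] D != 0 by [].
  by rewrite contract_orthogonal //; apply/forallP => z; rewrite cD.
have [/eqP->|] := boolP (contract form [ffun x => u (c x)] E == 0);
  first by rewrite mulr0.
rewrite contract_orthogonal // => /forallP cE.
have [e|lt] := cmax E (fun z => eqP (cE z)); first by rewrite e eqxx in ED.
by rewrite IHk ?mul0r //; apply: leq_trans lek; apply: lexlt_below.
Qed.

(** * The action on the tensor power *)

Section Action.
Variables (K : fieldType) (m n : nat) (V : vectType K) (v : m.-tuple V).
Variables (T : lmodType K) (tens : {ffun 'I_n -> V} -> T).
Variable (act : T -> brauer K m n -> T).
Hypotheses (v_basis : basis_of fullv v) (tensP : tensor_power tens).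
Hypothesis actP : brauer_action (tnth v) tens act.
Implicit Types (D : bdiag n) (i j : {ffun 'I_n -> 'I_m}) (w : 'S_n) (a : 'I_n).

Definition act_by x : {linear T -> T} := HB.pack (act^~ x)
  (GRing.isLinear.Build _ _ _ _ (act^~ x) (brauer_act_linearl actP x)).
Definition act_on t : {linear brauer K m n -> T} := HB.pack (act t)
  (GRing.isLinear.Build _ _ _ _ (act t) (brauer_act_linearr actP t)).

Lemma act_suml x (I : Type) (r : seq I) (P : pred I) F :
  act (\sum_(i <- r | P i) F i) x = \sum_(i <- r | P i) act (F i) x.
Proof. exact: (linear_sum (act_by x)). Qed.

Lemma actZl x k t : act (k *: t) x = k *: act t x.
Proof. by rewrite -[LHS]/(act_by x (k *: t)) linearZ. Qed.

Lemma act_sumr t (I : Type) (r : seq I) (P : pred I) F :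
  act t (\sum_(i <- r | P i) F i) = \sum_(i <- r | P i) act t (F i).
Proof. exact: (linear_sum (act_on t)). Qed.

Lemma actZr t k x : act t (k *: x) = k *: act t x.
Proof. by rewrite -[LHS]/(act_on t (k *: x)) linearZ. Qed.

Definition basis_tensor i : T := tens [ffun a => tnth v (i a)].

(** The dual basis of v_j is v_(rev_ord j), so that the matrix entry of a
diagram at (i, j) is its value on this colouring. *)
Definition boundary i j (x : bvertex n) : 'I_m :=
  match x with inl a => i a | inr a => rev_ord (j a) end.

Definition acts_by_matching D := forall i,
  act (basis_tensor i) (bd_basis K m D) =
    \sum_j (fits D (boundary i j))%:R *: basis_tensor j.

Lemma act_comp A B t : bd_loops A B = 0%N ->
  act t (bd_basis K m (bd_comp A B)) =
    act (act t (bd_basis K m A)) (bd_basis K m B).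
Proof.
move=> AB0; rewrite -(brauer_actM actP); congr act.
by rewrite [RHS]brauer_mul_basis AB0 expr0 scale1r.
Qed.

Lemma fits_one i j : fits (bd_one n) (boundary i j) = (j == i).
Proof.
apply/fitsP/eqP => [H|-> [] a]; rewrite ?bd_oneE //=; last by rewrite rev_ordK.
apply/ffunP => a; apply: rev_ord_inj.
by have := H (inl a); rewrite bd_oneE.
Qed.

Lemma sum_delta i (F : {ffun 'I_n -> 'I_m} -> T) :
  \sum_j (j == i)%:R *: F j = F i.
Proof.
rewrite (bigD1 i) //= eqxx scale1r big1 ?addr0 // => j /negbTE->.
by rewrite scale0r.
Qed.

Lemma acts_one : acts_by_matching (bd_one n).
Proof.
move=> i; under eq_bigr do rewrite fits_one; rewrite sum_delta.
exact: brauer_act1 actP _.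
Qed.

Lemma act_s_basis (s : 'I_n.-1) i :
  act (basis_tensor i) (bd_basis K m (bd_s s)) =
    basis_tensor [ffun a => i (sperm s a)].
Proof.
rewrite /basis_tensor (brauer_act_s actP); congr tens.
by apply/ffunP => a; rewrite !ffunE.
Qed.

Lemma acts_sl (s : 'I_n.-1) D : acts_by_matching D ->
  acts_by_matching (bd_conj (top_perm (sperm s)) D).
Proof.
move=> DP i; have [l0 e] := bd_comp_perml (sperm s) D.
rewrite -[sperm s]invgK [in X in top_perm X]tpermV -e act_comp //.
rewrite act_s_basis DP; apply: eq_bigr => j _; congr (_%:R *: _).
rewrite e; congr (nat_of_bool _); symmetry; apply: fits_conj => -[] a;
  rewrite rowpE //=.
by rewrite ffunE tpermV.
Qed.

Lemma acts_sr (s : 'I_n.-1) D : acts_by_matching D ->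
  acts_by_matching (bd_conj (bot_perm (sperm s)) D).
Proof.
move=> DP i; have [l0 e] := bd_comp_permr (sperm s) D.
rewrite -e act_comp // DP act_suml.
pose f j : {ffun 'I_n -> 'I_m} := [ffun a => j (sperm s a)].
have fK : involutive f by move=> j; apply/ffunP => a; rewrite !ffunE tpermK.
rewrite [RHS](reindex_inj (inv_inj fK)); apply: eq_bigr => j _.
rewrite actZl act_s_basis; congr (_%:R *: _).
rewrite e; congr (nat_of_bool _); symmetry; apply: fits_conj => -[] a;
  rewrite rowpE //=.
by rewrite ffunE tpermK.
Qed.

Lemma acts_top w D :
  acts_by_matching D -> acts_by_matching (bd_conj (top_perm w) D).
Proof.
move=> DP; have [k /existsP[t /eqP->]] := has_word_ex w.
elim: (tval t) D DP => [|s ts IHts] D DP;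
  first by rewrite big_nil top_perm1 bd_conj1.
by rewrite big_cons top_permM bd_conjM; apply/IHts/acts_sl.
Qed.

Lemma acts_bot w D :
  acts_by_matching D -> acts_by_matching (bd_conj (bot_perm w) D).
Proof.
move=> DP; have [k /existsP[t /eqP->]] := has_word_ex w.
elim: (tval t) D DP => [|s ts IHts] D DP.
  rewrite big_nil (_ : bot_perm 1 = 1%g) ?bd_conj1 //.
  by apply/permP => -[] a; rewrite rowpE !perm1.
rewrite big_cons (_ : bot_perm _ =
  bot_perm (sperm s) * bot_perm (\prod_(j <- ts) sperm j))%g.
  by rewrite bd_conjM; apply/IHts/acts_sr.
by apply/permP => -[] a; rewrite permM !rowpE ?permM.
Qed.

(** Since the strands touched by e_s are vertical in [D], only one term of the
sum in the action of e_s contributes to a given output tensor. *)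
Lemma acts_el (s : 'I_n.-1) D : one_on (adj s) D -> acts_by_matching D ->
  acts_by_matching (bd_conj (tperm (inl (adjl s)) (inr (adjr s))) D).
Proof.
move=> D1 DP i; have [l0 e] := bd_comp_el D1.
rewrite -e act_comp // (brauer_act_e actP).
set l := adjl s; set r := adjr s; have lr : l != r := adj_neq s.
(* basis_tensor (i2 k) is the k-th term of the sum in the action of e_s. *)
pose i2 k : {ffun 'I_n -> 'I_m} :=
  [ffun a => if a == r then rev_ord k else if a == l then k else i a].
have -> : \sum_(k < m) tens (fupd (fupd [ffun a => tnth v (i a)]
        l (tnth v k)) r (tnth v (rev_ord k))) = \sum_k basis_tensor (i2 k).
  apply: eq_bigr => k _; congr tens; apply/ffunP => a; rewrite !ffunE.
  by case: eqP => //; case: eqP.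
rewrite actZl act_suml /= scaler_sumr.
have DPk k : (i l == rev_ord (i r))%:R *: act (basis_tensor (i2 k))
  (bd_basis K m D) =
    \sum_j (i l == rev_ord (i r))%:R *:
      ((fits D (boundary (i2 k) j))%:R *: basis_tensor j).
  by rewrite DP scaler_sumr.
rewrite (eq_bigr _ (fun k _ => DPk k)) exchange_big; apply: eq_bigr => j _ /=.
under eq_bigr do rewrite scalerA; rewrite -scaler_suml; congr (_ *: _).
have vert a k : adj s a -> fits D (boundary (i2 k) j) -> j a = i2 k a.
  by move=> sa /fitsP/(_ (inl a)); rewrite D1 // bd_oneE /= => /rev_ord_inj.
rewrite -mulr_sumr (bigD1 (j l)) //= big1 ?addr0 => [|k kj]; last first.
  case: (boolP (fits _ _)) => // /(vert l); rewrite /adj eqxx => /(_ isT).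
  by rewrite ffunE (negbTE lr) eqxx => e'; rewrite e' eqxx in kj.
rewrite -natrM mulnb; congr (nat_of_bool _)%:R.
have eDx x : bd_conj (tperm (inl l) (inr r)) D x =
  if adj s (strand x) then bd_e s x else D x.
  exact: bd_conj_el.
rewrite e; apply/andP/fitsP => [[/eqP ilr fD] x|H].
  rewrite eDx; case: ifPn => sx.
    rewrite bd_e_cap bd_capE ?adj_neq //.
    have jr : j r = rev_ord (j l).
      by rewrite (vert r _ _ fD) ?ffunE ?eqxx // /adj eqxx orbT.
    case: x sx => a /orP[] /= /eqP-> /=;
      rewrite eqxx ?[adjr s == _]eq_sym ?(negbTE (adj_neq s)) /=.
    - by rewrite ilr rev_ordK.
    - by rewrite ilr.
    - by rewrite jr.
    - by rewrite jr !rev_ordK.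
  have off y : ~~ adj s (strand y) -> boundary (i2 (j l)) j y = boundary i j y.
    by case: y => y //=; rewrite negb_or ffunE => /andP[/negbTE-> /negbTE->].
  have := fitsP _ _ fD x; rewrite !off //.
  by rewrite (one_on_strand _ D1).
have sl : adj s l by rewrite /adj eqxx.
have ilr : i r = rev_ord (i l).
  by have := H (inl l); rewrite eDx [strand _]/=
    sl bd_e_cap bd_capE ?adj_neq //= eqxx.
have jlr : j r = rev_ord (j l).
  by have := H (inr l); rewrite eDx [strand _]/=
    sl bd_e_cap bd_capE ?adj_neq //= eqxx => /rev_ord_inj.
split; first by rewrite ilr rev_ordK.
apply/fitsP => x; have [sx|sx] := boolP (adj s (strand x)).
  rewrite D1 // bd_oneE; case: x sx => a /orP[] /= /eqP-> /=;
    rewrite ffunE ?eqxx ?(negbTE lr) -/l -/r ?rev_ordK ?eqxx //.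
  by rewrite jlr rev_ordK.
have off y : ~~ adj s (strand y) -> boundary (i2 (j l)) j y = boundary i j y.
  by case: y => y //=; rewrite negb_or ffunE => /andP[/negbTE-> /negbTE->].
rewrite !off //; last by rewrite (one_on_strand _ D1).
by have := H x; rewrite eDx (negbTE sx).
Qed.

(** A factorization reduces a diagram to generators, one at a time and without
loops. *)
Lemma acts_all D : acts_by_matching D.
Proof.
have [[[[f d1] d2] s] /bd_factors_conj->] := bd_factors_ex D.
rewrite !bd_conjM; apply/acts_bot/acts_bot/acts_top.
rewrite bd_e_oddE; elim: (e_seq n f) (e_seq_even n f) => [|j js IHjs] ok.
  exact: acts_one.
have [one [_ ->]] := e_fold_cons ok; apply: acts_el => //.
exact/IHjs/(even_seq_cons ok).
Qed.

Lemma act_basis_tensor i x : act (basis_tensor i) x =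
  \sum_j pairing (fun D => (fits D (boundary i j))%:R) x *: basis_tensor j.
Proof.
rewrite {1}(brauerE x) act_sumr.
under eq_bigr do rewrite actZr acts_all scaler_sumr.
rewrite exchange_big; apply: eq_bigr => j _; rewrite scaler_suml.
by apply: eq_bigr => D _; rewrite scalerA.
Qed.

(** The basis tensors generate the tensor power and are linearly independent,
both by the universal property. *)
Lemma annihilatorP x : (forall t, act t x = 0) <->
  forall c : bvertex n -> 'I_m, pairing (fun D => (fits D c)%:R) x = 0.
Proof.
split=> [x0 c|x0].
  pose i : {ffun 'I_n -> 'I_m} := [ffun a => c (inl a)].
  pose j : {ffun 'I_n -> 'I_m} := [ffun a => rev_ord (c (inr a))].
  have cE : boundary i j =1 c by case=> a; rewrite /= ffunE ?rev_ordK.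
  (* The coordinate form at the basis tensor j. *)
  pose t (f : {ffun 'I_n -> V}) : K^o := \prod_a coord v (j a) (f a).
  have tlin : multilinear t.
    move=> f a; have tE (w : V) : t (fupd f a w) =
        coord v (j a) w * \prod_(k | k != a) coord v (j k) (f k).
      rewrite /t (bigD1 a) //= [fupd f a w a]ffunE eqxx; congr (_ * _).
      by apply: eq_bigr => k /negbTE ka; rewrite [fupd f a w k]ffunE ka.
    by move=> b w w'; rewrite !tE linearP mulrDl /GRing.scale /= mulrA.
  have [h hE _] := tensP.2 _ _ tlin.
  have hb k : h (basis_tensor k) = (k == j)%:R.
    rewrite hE /t; have [->|kj] := eqVneq.
      apply: big1 => a _; rewrite [X in coord _ _ X]ffunE (tnth_nth 0)
        coord_free ?eqxx //.
      exact: basis_free v_basis.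
    have /existsP[a ka] : [exists a, k a != j a].
      by apply: contraNT kj => /existsPn H; apply/eqP/ffunP => a; apply/eqP;
        rewrite -[_ == _]negbK H.
    rewrite (bigD1 a) //= [X in coord _ _ X]ffunE (tnth_nth 0) coord_free
      ?(basis_free v_basis) //.
    by rewrite (negbTE ka) mul0r.
  have := congr1 h (x0 (basis_tensor i));
    rewrite act_basis_tensor linear_sum linear0.
  under eq_bigr do rewrite linearZ /= hb.
  rewrite (bigD1 j) //= eqxx big1 => [|k /negbTE->]; last by rewrite scaler0.
  rewrite addr0 /GRing.scale /= mulr1 => <-; apply: eq_bigr => D _.
  congr (_ * (nat_of_bool _)%:R); apply: eq_forallb => y.
  by rewrite !cE.
have actb i : act (basis_tensor i) x = 0.
  by rewrite act_basis_tensor big1 // => j _; rewrite x0 scale0r.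
have actf f : act (tens f) x = 0.
  move: f; apply: (multilinear_ext v_basis (t := fun f => act (tens f) x)).
    move=> f a b w w'; rewrite [LHS](congr1 (act^~ x) (tensP.1 f a b w w')).
    exact: (brauer_act_linearl actP).
  move=> c; rewrite -(actb [ffun a => c a]) /basis_tensor;
    congr (act (tens _) _).
  by apply/ffunP => a; rewrite !ffunE.
have zlin : multilinear (fun _ : {ffun 'I_n -> V} => 0 : T).
  by move=> f a b w w'; rewrite scaler0 addr0.
have [h hE hU] := tensP.2 _ _ zlin.
have z : forall f, (\0 : {linear T -> T}) (tens f) = 0 by [].
by move=> t; rewrite -[LHS]/(act_by x t) (hU (act_by x) actf) -(hU \0 z).
Qed.

End Action.

(** * The ideal generated by the elements E_i *)

Section Ideal.
Variables (K : fieldType) (m n : nat).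
Implicit Types (D : bdiag n) (B S : {set bvertex n}).
Implicit Types (p q : {perm bvertex n}) (w : 'S_n).

Lemma bd_basisM A D : bd_loops A D = 0%N ->
  bd_basis K m A * bd_basis K m D = bd_basis K m (bd_comp A D).
Proof. by move=> l0; rewrite [LHS]brauer_mul_basis l0 expr0 scale1r. Qed.

(** Multiplication by a diagram commutes with antisymmetrization as soon as it
undoes the same relabelling in all the terms. *)
Lemma bd_antisym_mull A q D B :
  (forall p, perm_on B p -> let E := bd_conj p D in
     bd_loops A (bd_conj q E) = 0%N /\ bd_comp A (bd_conj q E) = E) ->
  bd_basis K m A * bd_antisym K m (bd_conj q D) (q @: B) = bd_antisym K m D B.
Proof.
move=> H; rewrite bd_antisym_conj mulr_sumr; apply: eq_bigr => p /H[l0 e].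
by rewrite -scalerAr bd_basisM ?e.
Qed.

Lemma bd_antisym_mulr A q D B :
  (forall p, perm_on B p -> let E := bd_conj p D in
     bd_loops (bd_conj q E) A = 0%N /\ bd_comp (bd_conj q E) A = E) ->
  bd_antisym K m (bd_conj q D) (q @: B) * bd_basis K m A = bd_antisym K m D B.
Proof.
move=> H; rewrite bd_antisym_conj mulr_suml; apply: eq_bigr => p /H[l0 e].
by rewrite -scalerAl bd_basisM ?e.
Qed.

Lemma top_permV w : top_perm w^-1 = ((top_perm w)^-1)%g.
Proof. by apply/eqP; rewrite eq_mulgV1 invgK -top_permM mulVg top_perm1. Qed.

Lemma bot_permV w : bot_perm w^-1 = ((bot_perm w)^-1)%g.
Proof. by rewrite !bot_perm_conj top_permV conjVg. Qed.

Lemma bd_antisym_top w D B :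
  bd_basis K m (bd_perm w) *
    bd_antisym K m (bd_conj (top_perm w) D) (top_perm w @: B) =
  bd_antisym K m D B.
Proof.
apply: bd_antisym_mull => p _ E;
  have [-> ->] := bd_comp_perml w (bd_conj (top_perm w) E).
by rewrite -bd_conjM top_permV mulgV bd_conj1.
Qed.

Lemma bd_antisym_bot w D B :
  bd_antisym K m (bd_conj (bot_perm w) D) (bot_perm w @: B) *
  bd_basis K m (bd_perm w^-1) = bd_antisym K m D B.
Proof.
apply: bd_antisym_mulr => p _ E;
  have [-> ->] := bd_comp_permr w^-1 (bd_conj (bot_perm w) E).
by rewrite -bd_conjM bot_permV mulgV bd_conj1.
Qed.

Definition is_top (x : bvertex n) := if x is inl _ then true else false.

Definition side (b : bool) : {set bvertex n} := [set x | is_top x == b].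

Lemma card_side b : #|side b| = n.
Proof.
rewrite -[RHS](card_ord n); case: b.
  rewrite -(card_imset _ (@inl_inj 'I_n 'I_n)); apply: eq_card => x;
    rewrite inE.
  apply/eqP/imsetP => [|[i _ ->]//]; by case: x => // i _; exists i.
rewrite -(card_imset _ (@inr_inj 'I_n 'I_n)); apply: eq_card => x; rewrite inE.
apply/eqP/imsetP => [|[i _ ->]//]; by case: x => // i _; exists i.
Qed.

Definition mate_closed D S := forall x, (D x \in S) = (x \in S).

(** Otherwise the edges would embed the vertices outside of [S] on one side into
those on the other side, against the count. *)
Lemma unbalanced_edge D S b : mate_closed D S ->
  (#|S :&: side (~~ b)| < #|S :&: side b|)%N ->
  exists x, [/\ x \notin S, is_top x = ~~ b & is_top (D x) = ~~ b].
Proof.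
move=> SD lt.
have [x xP|none] := pickP
  [pred x | [&& x \notin S, is_top x == ~~ b & is_top (D x) == ~~ b]].
  by exists x; case/and3P: xP => ? /eqP ? /eqP.
move: lt; rewrite ltnNge => /negP[].
have c1 := cardsID S (side b); have c2 := cardsID S (side (~~ b)).
have le : (#|side (~~ b) :\: S| <= #|side b :\: S|)%N.
  rewrite -(card_imset _ (inv_inj (bd_invol D))); apply/subset_leq_card/subsetP.
  move=> _ /imsetP[x + ->]; rewrite !inE SD => /andP[xS xb].
  rewrite xS /=; have := none x; rewrite /= xS xb /=.
  by case: (is_top (D x)); case: b {c1 c2 xb none}.
rewrite -(leq_add2r #|side b :\: S|) [S :&: side b]setIC c1.
by rewrite (etrans (card_side b) (esym (card_side (~~ b)))) -c2 setIC leq_add2l.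
Qed.

Lemma perm_to_intervals (S1 S2 : {set 'I_n}) : [disjoint S1 & S2] ->
  exists w : 'S_n, (forall i, (w i < #|S1|)%N = (i \in S1)) /\
    (forall i, (#|S1| <= w i < #|S1| + #|S2|)%N = (i \in S2)).
Proof.
move=> dis; pose l := enum S1 ++ enum S2 ++ enum (~: (S1 :|: S2)).
have lP i : i \in l.
  by rewrite !mem_cat !mem_enum !inE; case: (i \in S1); case: (i \in S2).
have szl : size l = n.
  rewrite !size_cat -!cardE addnA -cardsUI (disjoint_setI0 dis) cards0 addn0.
  by rewrite cardsC card_ord.
have lt i : (index i l < n)%N by rewrite -[X in (_ < X)%N]szl index_mem.
have inj : injective (fun i => Ordinal (lt i)).
  by move=> i j [/(congr1 (nth i l))]; rewrite !nth_index.
have wE i : perm inj i = index i l :> nat by rewrite permE.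
exists (perm inj); split=> i; rewrite wE /l index_cat mem_enum.
  by case: ifP => iS; rewrite cardE ?index_mem ?mem_enum // ltnNge leq_addr.
case: ifP => iS; rewrite [#|S1|]cardE.
  rewrite leqNgt index_mem mem_enum iS /=; apply/esym/negbTE.
  by rewrite (disjointFr dis).
rewrite leq_addr ltn_add2l index_cat mem_enum.
by case: ifP => iS2; rewrite cardE ?index_mem ?mem_enum // ltnNge leq_addr.
Qed.

Variable I : brauer K m n -> Prop.
Hypothesis I_ideal : two_sided_ideal I.
Hypothesis I_E : forall i, (i <= (m.+1)./2)%N -> I (brauer_E K m n i).

Let I_l a x : I x -> I (a * x). Proof. by case: I_ideal => _ _ + _; apply. Qed.
Let I_r a x : I x -> I (x * a). Proof. by case: I_ideal => _ _ _; apply. Qed.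

Lemma ideal_scale a x : I x -> I (a *: x).
Proof. by move=> Ix; rewrite -[x]mul1r scalerAl; apply: I_l. Qed.

(** [D] is the identity on the first m + 1 strands, those that E_{a,b} moves, so
that multiplication by [D] fills in its other strands. *)
Lemma ideal_vertical a b D : (a + b = m.+1)%N -> (a <= (m.+1)./2)%N ->
  one_on (fun i : 'I_n => i < a + b)%N D ->
  I (bd_antisym K m D [set x | tgt_pred a b x]).
Proof.
move=> ab am D1; set B := [set x | _].
have P (x : bvertex n) : x \in B -> (strand x < a + b)%N.
  by rewrite inE; case: x => i /= => [/andP[]//|/leq_trans]; apply;
    apply: leq_addr.
suff -> : bd_antisym K m D B = bd_antisym K m (bd_one n) B * bd_basis K m D.
  by apply: I_r; have := I_E am; rewrite /brauer_E -ab addKn brauer_E2_antisym.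
rewrite mulr_suml; apply: eq_bigr => p pB.
have pP x : (strand (p x) < a + b)%N = (strand x < a + b)%N.
  have [xB|xB] := boolP (x \in B); last by rewrite (out_perm pB).
  by rewrite !P // (perm_closed _ pB).
have fixp x : ~~ (strand x < a + b)%N -> p x = x.
  by move=> xP; apply: (out_perm pB); apply: contra xP; apply: P.
have [l0 e] : bd_loops (bd_conj p (bd_one n)) D = 0%N /\
              bd_comp (bd_conj p (bd_one n)) D = bd_conj p D.
  apply: (@bd_comp_union _ (fun i : 'I_n => i < a + b)%N) => // x.
    move=> xP; rewrite -{1}(fixp x xP) bd_conj_apply fixp //.
    by rewrite strand_one.
  rewrite -[x](permKV p) pP !bd_conj_apply; set y := (p^-1)%g x.
  case: ifPn => yP; first by rewrite D1.
  rewrite (fixp y) // fixp //; by rewrite (one_on_strand _ D1).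
by rewrite -scalerAl bd_basisM ?e.
Qed.

(** A permutation of the targets makes the first m + 1 strands of [D] vertical
and only changes the sign of the minor. *)
Lemma ideal_standard a b D : (a + b = m.+1)%N -> (a <= (m.+1)./2)%N ->
  (forall x, src_pred a b (D x) = tgt_pred a b x) ->
  I (bd_antisym K m D [set x | tgt_pred a b x]).
Proof.
move=> ab am Dsrc; set B := [set x | _].
have Dtgt x : tgt_pred a b (D x) = src_pred a b x by rewrite -Dsrc bd_invol.
pose f x := if tgt_pred a b x then bd_one n (D x) else x.
have ft x : tgt_pred a b (f x) = tgt_pred a b x.
  by rewrite /f; case: ifP => // tx; rewrite tgt_pred_one Dsrc.
have f_inj : injective f.
  move=> x y e; have := ft x; rewrite e ft /f => t; move: e; rewrite /f t.
  by case: ifP => // _ /(inv_inj (bd_invol (bd_one n)))/(inv_inj (bd_invol D)).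
pose q := perm f_inj.
have qB : perm_on B q.
  by apply/subsetP => x; rewrite !inE permE /f; apply: contraR => /negbTE->.
have q_src x : src_pred a b x -> bd_conj q D x = bd_one n x.
  move=> sx; have qx : q x = x by rewrite permE /f src_not_tgt.
  by rewrite -{1}qx bd_conj_apply permE /f Dtgt sx bd_invol.
have q1 : one_on (fun i : 'I_n => i < a + b)%N (bd_conj q D).
  move=> x xab; have [sx|nsx] := boolP (src_pred a b x); first exact: q_src.
  have tx : tgt_pred a b x.
    case: x xab nsx => i /=; rewrite -?leqNgt => -> //; first by move->.
    by rewrite andbT -ltnNge.
  by rewrite -{1}[x](bd_invol (bd_one n)) -q_src ?bd_invol // src_pred_one.
have := ideal_scale ((-1) ^+ odd_perm q) (ideal_vertical ab am q1).
by rewrite bd_antisym_on // scalerA -signr_addb addbb scale1r.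
Qed.

Lemma card_top_part S : #|[set i | inl i \in S]| = #|S :&: side true|.
Proof.
rewrite -(card_imset _ (@inl_inj 'I_n 'I_n)); apply: eq_card => x; rewrite !inE.
apply/imsetP/andP => [[i + ->]|[xS]]; first by rewrite inE.
by case: x xS => // i iS _; exists i; rewrite ?inE.
Qed.

Lemma card_bot_part S : #|[set i | inr i \in S]| = #|S :&: side false|.
Proof.
rewrite -(card_imset _ (@inr_inj 'I_n 'I_n)); apply: eq_card => x; rewrite !inE.
apply/imsetP/andP => [[i + ->]|[xS]]; first by rewrite inE.
by case: x xS => // i iS _; exists i; rewrite ?inE.
Qed.

Lemma card_sides S : (#|S :&: side true| + #|S :&: side false| = #|S|)%N.
Proof.
rewrite -(cardsID (side true) S); congr (_ + #|pred_of_set _|)%N.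
by apply/setP => x; rewrite !inE andbC; case: (is_top x).
Qed.

Lemma balanced_sides D B : [disjoint D @: B & B] ->
  #|(B :|: D @: B) :&: side true| = #|B| ->
  #|D @: B :&: side true| = #|B :&: side false| /\
  #|D @: B :&: side false| = #|B :&: side true|.
Proof.
move=> dis bal; have sB := card_sides B; have sM := card_sides (D @: B).
rewrite card_imset in sM; last exact: inv_inj (bd_invol D).
have sU : (#|B :&: side true| + #|D @: B :&: side true| = #|B|)%N.
  rewrite -bal setIUl -cardsUI (_ : _ :&: _ :&: _ = set0) ?cards0 ?addn0 //.
  apply/setP => x; rewrite !inE; apply/negP => /andP[/andP[xB _] /andP[xM _]].
  by rewrite (disjointFr dis xM) in xB.
split; first by apply: (@addnI #|B :&: side true|); rewrite sU sB.
by apply: (@addnI #|D @: B :&: side true|); rewrite sM addnC sU.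
Qed.

(** When half of the rows and columns of the minor lie in the top row, row
permutations, which are multiplications by units, bring it to the standard
position. *)
Lemma ideal_balanced_le D B : #|B| = m.+1 -> [disjoint D @: B & B] ->
  #|(B :|: D @: B) :&: side true| = m.+1 ->
  (#|B :&: side false| <= (m.+1)./2)%N ->
  I (bd_antisym K m D B).
Proof.
move=> cB dis bal am; set M := D @: B in dis bal.
have dis_part (g : 'I_n -> bvertex n) :
  [disjoint [set i | g i \in M] & [set i | g i \in B]].
  rewrite disjoint_subset; apply/subsetP => i; rewrite !inE => iM.
  by rewrite (disjointFr dis).
have [wt [wtM wtB]] := perm_to_intervals (dis_part inl).
have dis_bot : [disjoint [set i | inr i \in B] & [set i | inr i \in M]].
  by rewrite disjoint_sym; apply: dis_part.
have [wb [wbB wbM]] := perm_to_intervals dis_bot.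
rewrite !(card_top_part, card_bot_part) in wtM wtB wbB wbM.
have sB := card_sides B; rewrite cB in sB.
have [eMt eMb] := balanced_sides dis (etrans bal (esym cB)).
rewrite eMt in wtM wtB; rewrite eMb in wbM.
set a := #|B :&: side false| in am wtM wtB wbB wbM sB.
set b := #|B :&: side true| in wtB wbM sB.
pose rho x := bot_perm wb (top_perm wt x).
have rhoB x : tgt_pred a b (rho x) = (x \in B).
  by case: x => i; rewrite /rho !rowpE /= ?wtB ?wbB inE.
have rhoM x : src_pred a b (rho x) = (x \in M).
  by case: x => i; rewrite /rho !rowpE /= ?wtM ?wbM inE.
have rho_onto x : exists y, x = rho y.
  by exists ((top_perm wt)^-1 ((bot_perm wb)^-1 x))%g; rewrite /rho !permKV.
rewrite -(bd_antisym_top wt); apply: I_l; rewrite -(bd_antisym_bot wb);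
  apply: I_r.
have -> : bot_perm wb @: (top_perm wt @: B) = [set x | tgt_pred a b x].
  apply/setP => x; have [y ->] := rho_onto x; rewrite inE rhoB.
  by rewrite !(mem_imset _ _ (@perm_inj _ _)).
apply: ideal_standard => //; first by rewrite addnC.
move=> x; have [y ->] := rho_onto x;
  rewrite !bd_conj_apply -!/(rho _) rhoM rhoB.
by rewrite mem_imset //; apply: inv_inj (bd_invol D).
Qed.

(** Exchanging rows and columns of the minor exchanges a and b, one of which is
at most (m + 1) / 2. *)
Lemma ideal_balanced D B : #|B| = m.+1 -> [disjoint D @: B & B] ->
  #|(B :|: D @: B) :&: side true| = m.+1 -> I (bd_antisym K m D B).
Proof.
move=> cB dis bal.
have [le|gt] := leqP #|B :&: side false| (m.+1)./2;
  first exact: ideal_balanced_le.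
have DDB : D @: (D @: B) = B.
  by rewrite -imset_comp -[RHS]imset_id; apply: eq_imset => x /=;
    rewrite bd_invol.
have cM : #|D @: B| = m.+1 by rewrite card_imset //;
  apply: inv_inj (bd_invol D).
rewrite -bd_antisym_mate //; apply: ideal_balanced_le => //.
- by rewrite DDB disjoint_sym.
- by rewrite DDB setUC.
have [_ ->] := balanced_sides dis (etrans bal (esym cB)).
have sB := card_sides B; rewrite cB in sB.
rewrite -(leq_add2r #|B :&: side false|) sB -[X in (X <= _)%N]odd_double_half
  -addnn.
by rewrite addnCA leq_add2l; apply: leq_trans gt; case: (odd _).
Qed.

Lemma tperm_side S b t x :
  t \in S -> x \notin S -> is_top t = b -> is_top x = ~~ b ->
  #|S :&: side b| = (#|tperm t x @: S :&: side b|).+1 /\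
  #|tperm t x @: S :&: side (~~ b)| = (#|S :&: side (~~ b)|).+1.
Proof.
move=> tS xS tb xb.
have memS y : (y \in tperm t x @: S) = (tperm t x y \in S).
  by rewrite -{1}[y](tpermK t x) mem_imset //; apply: perm_inj.
split.
  rewrite (cardsD1 t) !inE tS tb eqxx add1n; congr (_.+1); apply: eq_card => y.
  rewrite !inE memS; case: tpermP => [->|->|/eqP/negbTE-> _] //.
    by rewrite eqxx (negbTE xS).
  by rewrite xb (negbTE xS) andbF; case: (b); rewrite andbF.
rewrite (cardsD1 x) !inE memS tpermR tS xb eqxx add1n; congr (_.+1);
  apply: eq_card => y.
rewrite !inE memS; case: tpermP => [->|->|_ /eqP/negbTE->] //.
  by rewrite tb (negbTE xS) andbF; case: (b); rewrite ?andbF.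
by rewrite eqxx (negbTE xS).
Qed.

Lemma conj_imset q D B : bd_conj q D @: (q @: B) = q @: (D @: B).
Proof.
by rewrite -!imset_comp; apply: eq_imset => x /=; rewrite bd_conj_apply.
Qed.

(** If one row contains too many vertices of the minor, then the other row
contains an edge outside of the minor. Multiplication by the cap at that edge
lets a vertex of the minor pass from one row to the other, so that induction on
the imbalance applies. *)
Lemma ideal_antisym D B : #|B| = m.+1 -> [disjoint D @: B & B] ->
  I (bd_antisym K m D B).
Proof.
pose gap D B := let S := B :|: D @: B in
  (#|S :&: side true| - #|S :&: side false| +
    (#|S :&: side false| - #|S :&: side true|))%N.
have [k] := ubnP (gap D B); elim: k D B => // k IHk D B;
  rewrite ltnS => lek cB dis.
set S := B :|: D @: B.
have SD : mate_closed D S.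
  have memD y : (D y \in D @: B) = (y \in B).
    by rewrite mem_imset //; apply: inv_inj (bd_invol D).
  by move=> y; rewrite !inE memD -(memD (D y)) bd_invol orbC.
have cS : (#|S :&: side true| + #|S :&: side false| = m.+1 + m.+1)%N.
  rewrite card_sides -{1}cB -(card_imset B (inv_inj (bd_invol D))) -cB /S setUC.
  by rewrite -cardsUI (disjoint_setI0 dis) cards0 addn0.
have step b : (#|S :&: side (~~ b)| < #|S :&: side b|)%N -> exists t x,
    [/\ is_top t = b, is_top x = ~~ b, is_top (D x) = ~~ b,
     (forall p, perm_on B p -> bd_conj p D x = D x) &
     I (bd_antisym K m (bd_conj (tperm t x) D) (tperm t x @: B))].
  move=> lt; have [x [xS xb Dxb]] := unbalanced_edge SD lt.
  have [t /setIP[tS]] : exists t, t \in S :&: side b.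
    by apply/set0Pn; rewrite -card_gt0; apply: leq_ltn_trans lt.
  rewrite inE => /eqP tb; exists t, x; split=> //.
    move=> p pB; have px : p x = x by apply: (out_perm pB); apply: contra xS;
      rewrite !inE => ->.
    rewrite -{1}px bd_conj_apply (out_perm pB) //; apply: contra xS => DxB.
    by rewrite -SD inE DxB.
  have [e1 e2] := tperm_side tS xS tb xb.
  apply: IHk; last 2 first.
  - by rewrite card_imset //; apply: perm_inj.
  - rewrite conj_imset disjoint_subset; apply/subsetP => _ /imsetP[y yD ->].
    by rewrite inE mem_imset ?(disjointFr dis) //; apply: perm_inj.
  apply: leq_trans lek; rewrite /gap conj_imset -imsetU -/S.
  move: cS lt e1 e2; case: (b) => /=.
    by move: #|_| #|_| #|_| #|_| => T B1 T' B1'; lia.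
  by move: #|_| #|_| #|_| #|_| => T B1 T' B1'; lia.
have [lt|gt|e] := ltngtP #|S :&: side true| #|S :&: side false|.
- have [t [x [tb xb Dxb Dx]]] := step false lt.
  case: t tb => // t _; case: x xb Dx Dxb => // p _ Dp;
    case eDp: (D (inl p)) => [q|//] _ Ia.
  rewrite -(@bd_antisym_mull (bd_flip (bd_cap p q)) (tperm (inr t) (inl p)));
    first exact: I_l.
  move=> r rB E; apply: bd_comp_capl.
  by rewrite Dp.
- have [t [x [tb xb Dxb Dx]]] := step true gt.
  case: t tb => // t _; case: x xb Dx Dxb => // p _ Dp;
    case eDp: (D (inr p)) => [//|q] _ Ia.
  rewrite -(@bd_antisym_mulr (bd_cap p q) (tperm (inl t) (inr p)));
    first exact: I_r.
  move=> r rB E; apply: bd_comp_capr.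
  by rewrite Dp.
apply: ideal_balanced => //; apply: double_inj; rewrite -!addnn -cS.
by congr (_ + _)%N.
Qed.

End Ideal.

(** * The annihilator *)

Lemma card_tgt_ge n a b : (a + b <= n)%N ->
  (a + b <= #|[set x : bvertex n | tgt_pred a b x]|)%N.
Proof.
move=> abn; pose f (k : 'I_(a + b)) : bvertex n :=
  if (k < a)%N then inr (widen_ord abn k) else inl (widen_ord abn k).
have f_inj : injective f.
  by move=> k l; rewrite /f; case: ifP; case: ifP => // _ _ [] /val_inj.
rewrite -[X in (X <= _)%N]card_ord -(card_image f_inj);
  apply/subset_leq_card/subsetP.
move=> _ /imageP[k _ ->]; rewrite inE /f; case: ltnP => //= ->.
by rewrite ltn_ord.
Qed.

Theorem theorem3p8 (K : fieldType) (charK : 2%N \notin [pchar K])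
    (m n : nat) (m_gt0 : (0 < m)%N) (n_gt0 : (0 < n)%N)
    (V : vectType K) (form : {symmetric V}) (form_nd : nondegenerate form)
    (v : m.-tuple V) (v_basis : basis_of fullv v)
    (form_v : forall i j : 'I_m,
       form (tnth v i) (tnth v j) = (i == rev_ord j)%:R)
    (T : lmodType K) (tens : {ffun 'I_n -> V} -> T)
    (tensP : tensor_power tens)
    (act : T -> brauer K m n -> T)
    (actP : brauer_action (tnth v) tens act)
    (m_lt_n : (m < n)%N) (x : brauer K m n) :
  (forall t : T, act t x = 0) <->
  two_sided_ideal_gen
    (fun y => exists2 i : nat, (i <= (m.+1)./2)%N & y = brauer_E K m n i) x.
Proof.
have annP := annihilatorP v_basis tensP actP.
split=> [/annP x0 I Iid IE | gx].
  have I_E i : (i <= (m.+1)./2)%N -> I (brauer_E K m n i) by move=> im;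
    apply: IE; exists i.
  case: (Iid) => I0 ID _ _.
  apply: (second_fundamental charK (form := fun w w' => form w w') _ _ v_basis
    form_v I0 ID _ _ x0).
  - by move=> w a w1 w2; rewrite linearPl.
  - by move=> w w'; rewrite hermC expr0 mul1r.
  - by move=> a y; apply: ideal_scale.
  - by move=> D B; apply: ideal_antisym.
apply: (gx (fun y => forall t, act t y = 0)) => [|_ [i im ->]].
  have act0 t : act t 0 = 0 by rewrite -[LHS]/(act_on actP t 0) linear0.
  have act0l z : act 0 z = 0 by rewrite -[LHS]/(act_by actP z 0) linear0.
  split=> [//|y z y0 z0 t|a y y0 t|a y y0 t].
  - by rewrite -[LHS]/(act_on actP t (y + z)) linearD /= y0 z0 addr0.
  - by rewrite (brauer_actM actP) y0.
  - by rewrite (brauer_actM actP) y0 act0l.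
apply/annP => c; rewrite /brauer_E brauer_E2_antisym.
have le : (i <= m.+1)%N by rewrite (leq_trans im) // -{2}(odd_double_half m.+1)
  -addnn addnA leq_addl.
rewrite fits_antisym //.
by have := @card_tgt_ge n i (m.+1 - i); rewrite subnKC //; apply.
Qed.
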